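(* Let $H>\frac12$, $h_0=\frac12$, $c_1>1$, $\Omega=(0,1)\times(0,H)$, $\Omega_0=(0,1)\times(0,h_0)$, $\Omega_1=(0,1)\times(h_0,H)$, let $c=1$ on $\Omega_0$ and $c=c_1$ on $\Omega_1$, and let $A=-c\Delta$ with Dirichlet boundary conditions. Let $\omega=\omega_1\times(a,b)$ be open with $\overline{\omega}\subset\Omega_1$. For each $k$ having at least one guided eigenvalue, let $\mathcal L_k$ be the number of guided eigenvalues $\lambda_{k,\ell}$, so that $\lambda_{k,\mathcal L_k}$ is the largest one. 1. There are positive constants $C_1',C_2'$ such that for all such $k$ $$C_1'e^{-C_2'\lambda_{k,\mathcal L_k}^{1/4}}\|v_{k,\mathcal L_k}\|^2_{L^2(\Omega)}\le\|v_{k,\mathcal L_k}\|^2_{L^2(\omega)}.$$ 2. If $\sqrt{c_1-1}\in\mathbb N$, there are positive constants $C_1,C_1',C_2,C_2'$ such that for all such $k$ $$C_1'e^{-C_2'\lambda_{k,\mathcal L_k}^{1/4}}\|v_{k,\mathcal L_k}\|^2_{L^2(\Omega)}\le\|v_{k,\mathcal L_k}\|^2_{L^2(\omega)}\le C_1e^{-C_2\lambda_{k,\mathcal L_k}^{1/4}}\|v_{k,\mathcal L_k}\|^2_{L^2(\Omega)}.$$ 3. If $\sqrt{c_1-1}\in\mathbb R\setminus\mathbb N$, there are positive constants $C_1,C_1',C_2,C_2'$ and a subsequence of guided eigenfunctions corresponding to eigenvalues $\lambda_{k,\mathcal L_k}$ (i.e. an infinite set of $k$) along which $$C_1'e^{-C_2'\lambda_{k,\mathcal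 L_k}^{1/4}}\|v_{k,\mathcal L_k}\|^2_{L^2(\Omega)}\le\|v_{k,\mathcal L_k}\|^2_{L^2(\omega)}\le C_1e^{-C_2\lambda_{k,\mathcal L_k}^{1/4}}\|v_{k,\mathcal L_k}\|^2_{L^2(\Omega)}.$$
   Context: $A=-c\Delta$ acts in $L^2(\Omega,c^{-1}dx)$ with domain $H^1_0(\Omega)\cap H^2(\Omega)$. For each integer $k\ge1$, $\lambda_{k,1}<\lambda_{k,2}<\cdots$ are the numbers $\lambda$ for which there is a nonzero $u_{k,\ell}\in H^2(0,H)$ with $u''+(\frac{\lambda}{c}-k^2\pi^2)u=0$, $u(0)=u(H)=0$; the eigenfunctions are $v_{k,\ell}(x)=a_{k,\ell}\sqrt2\sin(k\pi x_1)u_{k,\ell}(x_2)$, $a_{k,\ell}\neq0$ a normalizing constant. The eigenvalue $\lambda_{k,\ell}$ (and $v_{k,\ell}$) is called guided if $k^2\pi^2<\lambda_{k,\ell}<c_1k^2\pi^2$. Here $\omega_1$ is a nonempty open subset of $(0,1)$ and $a<b$. *)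

(* Defs.v *)
From HB Require Import structures.
From mathcomp Require Import all_boot all_order all_algebra.
From mathcomp Require Import finmap.
From mathcomp Require Import all_classical all_reals all_analysis.

Set Implicit Arguments.
Unset Strict Implicit.
Unset Printing Implicit Defensive.

Import Order.TTheory GRing.Theory Num.Theory.
Import numFieldNormedType.Exports.

Local Open Scope classical_set_scope.
Local Open Scope ring_scope.

Section SobolevInterval.
Context {R : realType}.
Implicit Types (p q : R) (u g phi : R -> R).

Local Notation leb := (@lebesgue_measure R).

Definition inL2 p q u : Prop := (u \_ `]p, q[) \in Lfun leb 2%:E.

(* Test functions are C^1_c(]p, q[), extended by 0 to R; testing against
   C^1_c or C^oo_c yields the same weak derivatives. *)
Definition test_function p q phi : Prop :=
  [/\ forall x, derivable phi x 1, continuous (derive1 phi),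
      compact (closure [set x | phi x != 0]) &
      closure [set x | phi x != 0] `<=` `]p, q[].

Definition weak_derivative p q u g : Prop :=
  forall phi, test_function p q phi ->
    \int[leb]_(x in `]p, q[) (u x * derive1 phi x)
    = - \int[leb]_(x in `]p, q[) (g x * phi x).

Definition inH2 p q u u' u'' : Prop :=
  [/\ inL2 p q u, inL2 p q u', inL2 p q u'',
      weak_derivative p q u u' & weak_derivative p q u' u''].

End SobolevInterval.

Section LayeredWaveguide.
Context {R : realType}.
Implicit Types (H lam : R) (k l : nat) (u : R -> R).

Local Notation leb := (@lebesgue_measure R).

Definition h0 : R := 2^-1.

Definition Omega H : set (R * R) := `]0, 1[ `*` `]0, H[.
Definition Omega1 H : set (R * R) := `]0, 1[ `*` `]h0, H[.

(* The coefficient c depends only on the second coordinate; its value on the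
   interface x2 = h0 is irrelevant, as it is only used almost everywhere. *)
Definition coef (c1 : R) (x2 : R) : R := if x2 < h0 then 1 else c1.

(* An element of H^2(0,H) is represented by its continuous representative on
   [0,H], so that the boundary values, and u <> 0, are pointwise statements. *)
Definition mode_function H (c1 : R) k lam u : Prop :=
  [/\ {within `[0, H], continuous u}, u 0 = 0, u H = 0,
      exists2 x, x \in `]0, H[ & u x != 0 &
      exists u' u'' : R -> R, inH2 0 H u u' u'' /\
        {ae leb, forall x, x \in `]0, H[ ->
           u'' x + (lam / coef c1 x - k%:R ^+ 2 * pi ^+ 2) * u x = 0}].

Definition mode_spectrum H (c1 : R) k : set R :=
  [set lam | exists u, mode_function H c1 k lam u].

(* lambda_{k,l}, for l >= 1: the element of the spectrum with exactly l
   elements of the spectrum (itself included) below it. *)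
Definition eigenval H (c1 : R) k l : R :=
  [get lam | mode_spectrum H c1 k lam /\
             (mode_spectrum H c1 k `&` [set mu | (mu <= lam)%R] #= `I_l)%card].

Definition guided H (c1 : R) k : set R :=
  mode_spectrum H c1 k `&`
  [set lam | k%:R ^+ 2 * pi ^+ 2 < lam < c1 * (k%:R ^+ 2 * pi ^+ 2)].

Definition has_guided H (c1 : R) k : Prop := (1 <= k)%N /\ guided H c1 k !=set0.

(* The guided set is finite; fset_set would return the empty set otherwise. *)
Definition nb_guided H (c1 : R) k : nat := (#|` fset_set (guided H c1 k)|)%fset.

Definition last_guided_eigenval H (c1 : R) k : R :=
  eigenval H c1 k (nb_guided H c1 k).

(* Every nonzero alpha is allowed, so all normalizations are covered. *)
Definition last_guided_eigenfun H (c1 : R) k (v : R * R -> R) : Prop :=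
  exists (alpha : R) (u : R -> R),
    [/\ alpha != 0, mode_function H c1 k (last_guided_eigenval H c1 k) u &
        v = fun x => alpha * Num.sqrt 2 * sin (k%:R * pi * x.1) * u x.2].

Definition sqnormL2 (D : set (R * R)) (v : R * R -> R) : \bar R :=
  (('N[(leb \x leb)%E]_2%:E[EFin \o (v \_ D)]) ^+ 2)%E.

Definition lower_estimate H (omega : set (R * R)) (C' C2' lam : R)
    (v : R * R -> R) : Prop :=
  ((C' * expR (- C2' * lam `^ (4^-1)))%:E * sqnormL2 (Omega H) v
     <= sqnormL2 omega v)%E.

Definition upper_estimate H (omega : set (R * R)) (C C2 lam : R)
    (v : R * R -> R) : Prop :=
  (sqnormL2 omega v
     <= (C * expR (- C2 * lam `^ (4^-1)))%:E * sqnormL2 (Omega H) v)%E.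

End LayeredWaveguide.

(* Main.v *)
Require Import Defs.
From HB Require Import structures.
From mathcomp Require Import all_boot all_order all_algebra.
From mathcomp Require Import finmap.
From mathcomp Require Import all_classical all_reals all_analysis.
From mathcomp Require Import measurable_realfun.
From mathcomp Require Import ring lra.

Set Implicit Arguments.
Unset Strict Implicit.
Unset Printing Implicit Defensive.

Import Order.TTheory GRing.Theory Num.Theory.
Import numFieldNormedType.Exports.

Local Open Scope classical_set_scope.
Local Open Scope ring_scope.

(** A mode [v = sin (k pi x1) u(x2)] is a product, so by Tonelli's theorem the
    ratio of its masses in [omega] and in [Omega] is the product of the ratios for
    the two factors. For [sin (k pi x1)] this ratio stays between two positive
    constants ([sqint_sin_uniform], [sqint_sin_le1]); everything happens in the
    profile [u].

    With [al^2 = lam - k^2 pi^2] and [be^2 = k^2 pi^2 - lam / c1], both positive for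
    a guided eigenvalue, [u] is [A sin (al x)] in the layer [(0, h0)] and
    [B sinh (be (H - x))] in the cladding [(h0, H)] ([guided_mode_form]). Hence it
    decays in the cladding like [exp (- be x)], and both estimates hold with
    [be] in place of [lam^(1/4)] ([strip_mass_ge], [strip_mass_le]). It remains to
    compare [be] with [lam^(1/4)], which is of the order of [sqrt k].

    The matching conditions at [h0] give a transcendental equation for [al]
    ([dispersion]), and [c1 be^2 = amax^2 - al^2] with the cut-off
    [amax = sqrt (c1 - 1) k pi]. Since
    [c1 be^2 = (amax - al) (amax + al)], the rate [be] is of the order of [sqrt k] as
    soon as [amax - al] stays between two positive constants for the largest root
    [al]. The upper bound always holds, because every period [2 pi] below [amax]
    contains a root ([dispersion_root_exists]). The lower bound holds when [amax]
    lies in the first half of a period ([dispersion_root_gap]): this is the case for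
    all [k] when [sqrt (c1 - 1)] is an integer, and for infinitely many [k] in
    general, because the distance from [sqrt (c1 - 1) k / 2] to the next integer
    doubles with [k] as long as it is less than one half
    ([lower_half_period_doubling]).

    The modes are only weak solutions. Testing with cubic splines shows that they
    are piecewise classical ([weak_affine], [weak_layered_solution]); conversely,
    the explicit functions attached to the roots of the dispersion relation are
    weak solutions ([dispersion_mode]). That the index counting all the guided
    eigenvalues designates the largest of them rests on the absence of eigenvalues
    up to [k^2 pi^2] ([mode_eigenvalue_gt], [last_guided_eigenval_max]). *)

(** * One-variable calculus *)

Section Calculus.
Context {R : realType}.
Implicit Types (f g F : R -> R) (x a b : R).

Lemma is_derive1_const (c x : R) : is_derive x 1 (fun=> c) 0.
Proof. exact: is_derive_cst. Qed.

Lemma is_derive1_id x : is_derive x 1 (fun y => y) 1.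
Proof. exact: is_derive_id. Qed.

Lemma is_derive1_add f g x (df dg : R) :
  is_derive x 1 f df -> is_derive x 1 g dg ->
  is_derive x 1 (fun y => f y + g y) (df + dg).
Proof. exact: is_deriveD. Qed.

Lemma is_derive1_opp f x (df : R) :
  is_derive x 1 f df -> is_derive x 1 (fun y => - f y) (- df).
Proof. exact: is_deriveN. Qed.

Lemma is_derive1_mul f g x (df dg : R) :
  is_derive x 1 f df -> is_derive x 1 g dg ->
  is_derive x 1 (fun y => f y * g y) (f x * dg + g x * df).
Proof. exact: is_deriveM. Qed.

Lemma is_derive1_exp f x (df : R) n : is_derive x 1 f df ->
  is_derive x 1 (fun y => f y ^+ n) (n%:R * f x ^+ n.-1 * df).
Proof.
move=> fd; have := is_deriveX n fd; rewrite /GRing.scale/=.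
by congr is_derive; apply/funext => y; rewrite exprfctE.
Qed.

Lemma is_derive1_compose f g x (df dg : R) :
  is_derive x 1 g dg -> is_derive (g x) 1 f df ->
  is_derive x 1 (fun y => f (g y)) (df * dg).
Proof. by move=> gd fd; exact: (is_derive1_comp fd gd). Qed.

Lemma is_derive1_sin g x (dg : R) : is_derive x 1 g dg ->
  is_derive x 1 (fun y => sin (g y)) (cos (g x) * dg).
Proof. by move=> gd; apply: is_derive1_compose. Qed.

Lemma is_derive1_cos g x (dg : R) : is_derive x 1 g dg ->
  is_derive x 1 (fun y => cos (g y)) (- sin (g x) * dg).
Proof. by move=> gd; apply: is_derive1_compose. Qed.

Lemma is_derive1_expR g x (dg : R) : is_derive x 1 g dg ->
  is_derive x 1 (fun y => expR (g y)) (expR (g x) * dg).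
Proof. by move=> gd; apply: is_derive1_compose. Qed.

Lemma is_derive_continuous f x (df : R) :
  is_derive x 1 f df -> {for x, continuous f}.
Proof.
by move=> [/derivable1_diffP df' _]; exact: differentiable_continuous.
Qed.

Lemma is_derive1E f x (df : R) : is_derive x 1 f df -> f^`()%classic x = df.
Proof. by move=> [_ <-]; rewrite derive1E. Qed.

End Calculus.

(** Differentiates an explicit expression and leaves the comparison with the announced
    derivative. Type class search is blocked because the instances that it finds
    express derivatives with scaling operations, out of the reach of [ring]. *)
Ltac der := notypeclasses refine (is_derive_eq _ _);
  [repeat first
  [ eassumption
  | match goal with H : context [is_derive _ _ _ _] |- _ => solve [apply: H => //] end
  | notypeclasses refine (is_derive1_const _ _) | notypeclasses refine (is_derive1_id _)
  | notypeclasses refine (is_derive1_add _ _) | notypeclasses refine (is_derive1_opp _)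
  | notypeclasses refine (is_derive1_sin _)
  | notypeclasses refine (is_derive1_cos _)
  | notypeclasses refine (is_derive1_expR _)
  | notypeclasses refine (is_derive1_exp _ _)
  | notypeclasses refine (is_derive1_mul _ _) ]|cbv beta].

Section Primitives.
Context {R : realType}.
Implicit Types (f g F : R -> R) (x a b : R).
Local Notation leb := (@lebesgue_measure R).

Lemma derivable_continuous f (df : R -> R) :
  (forall x, is_derive x 1 f (df x)) -> continuous f.
Proof. by move=> fd x; apply: is_derive_continuous (fd x). Qed.

Lemma continuous_within f a b : (forall x, a <= x <= b -> {for x, continuous f}) ->
  {within `[a, b], continuous f}.
Proof.
move=> cf; apply: continuous_in_subspaceT => x.
by rewrite inE/= in_itv/= => /cf.
Qed.

Lemma derive_ge0_ndecr f (df : R -> R) a b :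
  (forall x, a <= x <= b -> {for x, continuous f}) ->
  (forall x, a < x < b -> is_derive x 1 f (df x)) ->
  (forall x, a < x < b -> 0 <= df x) ->
  forall x y, a <= x -> x <= y -> y <= b -> f x <= f y.
Proof.
move=> cf fd df0 x y ax xy yb.
apply: (@ger0_derive1_ndecr _ f a b) => //.
- by move=> z; rewrite in_itv/= => /fd[].
- move=> z; rewrite in_itv/= => zab; rewrite (is_derive1E (fd z zab)).
  exact: df0.
- exact: continuous_within.
Qed.

Lemma derive0_cst f a b :
  (forall x, a <= x <= b -> {for x, continuous f}) ->
  (forall x, a < x < b -> is_derive x 1 f 0) ->
  forall x, a <= x <= b -> f x = f a.
Proof.
move=> cf fd x /andP[ax xb]; apply/eqP; rewrite eq_le; apply/andP; split.
  rewrite -lerN2; apply: (@derive_ge0_ndecr (fun y => - f y) (fun=> 0) a b) => //.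
    by move=> y yab; apply: cvgN; exact: cf.
  by move=> y yab; der; rewrite ?oppr0.
exact: (@derive_ge0_ndecr f (fun=> 0) a b).
Qed.

Lemma derive_eq_const f g (df : R -> R) a b :
  (forall x, a <= x <= b -> {for x, continuous f}) ->
  (forall x, a <= x <= b -> {for x, continuous g}) ->
  (forall x, a < x < b -> is_derive x 1 f (df x)) ->
  (forall x, a < x < b -> is_derive x 1 g (df x)) ->
  forall x, a <= x <= b -> f x - g x = f a - g a.
Proof.
move=> cf cg fd gd x xab.
apply: (@derive0_cst (fun y => f y - g y) a b) => //.
  by move=> y yab; apply: cvgB; [exact: cf|exact: cg].
by move=> y yab; der; rewrite subrr.
Qed.

Lemma continuous_integrable f a b : continuous f ->
  leb.-integrable `[a, b] (EFin \o f).
Proof.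
move=> cf; apply: continuous_compact_integrable; first exact: segment_compact.
exact: continuous_subspaceT.
Qed.

Lemma primitive_right f a : continuous f ->
  exists F, forall x, a < x -> is_derive x 1 F (f x).
Proof.
move=> cf.
exists (fun x => \int[leb]_(t in [set` Interval (BLeft a) (BRight x)]) f t) => x ax.
have [] := @continuous_FTC1 R f (BLeft a) x (x + 1) _ _ _ (cf x).
- by rewrite ltrDl.
- exact: continuous_integrable.
- by rewrite lte_fin.
by move=> Fd; rewrite derive1E => Fx; exact: (DeriveDef Fd Fx).
Qed.

Lemma near_between a b x : a < x < b -> \near x, a < x < b.
Proof.
move=> xab; near=> y; near: y.
have : x \in `]a, b[ by rewrite in_itv.
by move/near_in_itvoo; apply: filterS => y; rewrite in_itv.
Unshelve. all: by end_near. Qed.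

Lemma is_derive_local f g x a b (df : R) : a < x < b ->
  (forall y, a < y < b -> f y = g y) -> is_derive x 1 f df ->
  is_derive x 1 g df.
Proof.
move=> xab fg; apply: near_eq_is_derive; apply: filterS (near_between xab).
exact: fg.
Qed.

(** Two one-sided primitives are glued on their common domain, where they differ
    by a constant. *)
Lemma primitive_exists f : continuous f ->
  exists F, forall x, is_derive x 1 F (f x).
Proof.
move=> cf; have [P Pd] := primitive_right (- 3) cf.
have cfN : continuous (fun x => f (- x)).
  by move=> x; apply: continuous_comp; [exact: opp_continuous|exact: cf].
have [Q Qd] := primitive_right (- 3) cfN.
have [N Nd] : exists N, forall x, x < 3 -> is_derive x 1 N (f x).
  exists (fun x => - Q (- x)) => x x3; have xN : - 3 < - x by rewrite ltrN2.
  have := is_derive1_opp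
    (is_derive1_compose (is_derive1_opp (is_derive1_id x)) (Qd _ xN)).
  by rewrite opprK mulrN1 opprK.
pose c := P (- 2) - N (- 2).
have PN x : - 2 <= x <= 2 -> P x = N x + c.
  move=> x2; apply/eqP; rewrite addrC -subr_eq; apply/eqP.
  apply: (@derive_eq_const P N f (- 2) 2) => //.
  - by move=> y y2; apply: is_derive_continuous (Pd y _); lra.
  - by move=> y y2; apply: is_derive_continuous (Nd y _); lra.
  - by move=> y y2; apply: Pd; lra.
  - by move=> y y2; apply: Nd; lra.
exists (fun x => if x < 0 then N x + c else P x) => x.
have [x1|x1] := ltP x 1.
  apply: (@is_derive_local (fun y => N y + c) _ x (x - 1) 1).
  - by rewrite x1 gtrBl ltr01.
  - move=> y /andP[_ y1]; case: ltP => // y0; rewrite PN//; lra.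
  - have Nx : is_derive x 1 N (f x) by apply: Nd; lra.
    by der; rewrite addr0.
apply: (@is_derive_local P _ x 0 (x + 1)).
- lra.
- by move=> y /andP[y0 _]; rewrite ltNge (ltW y0).
- by apply: Pd; lra.
Qed.

(** [F] need not be differentiable at the end points: primitives with a corner at
    the interface are used on each side of it. *)
Lemma Rintegral_derive f F a b : a < b -> continuous f -> continuous F ->
  (forall x, a < x < b -> is_derive x 1 F (f x)) ->
  \int[leb]_(x in `[a, b]) f x = F b - F a.
Proof.
move=> ab cf cF Fd; rewrite /Rintegral (@continuous_FTC2 R f F a b)//.
- exact: continuous_subspaceT.
- split; first by move=> x; rewrite in_itv/= => /Fd[].
  + by apply: cvg_at_right_filter; exact: cF.
  + by apply: cvg_at_left_filter; exact: cF.
- by move=> x; rewrite in_itv/= => /Fd /is_derive1E.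
Qed.

Lemma Rintegral_oo_cc f a b : continuous f ->
  \int[leb]_(x in `]a, b[) f x = \int[leb]_(x in `[a, b]) f x.
Proof.
move=> cf; have fi := continuous_integrable a b cf.
rewrite Rintegral_itv_bndo_bndc ?Rintegral_itv_obnd_cbnd//.
- by apply: integrableS fi => // x /=; rewrite !in_itv/= => /andP[/ltW -> ->].
- apply: integrableS fi => // x /=; rewrite !in_itv/= => /andP[/ltW -> /ltW ->] //.
Qed.

Lemma Rintegral_split f a b c : a <= b -> b <= c -> continuous f ->
  \int[leb]_(x in `[a, c]) f x =
  \int[leb]_(x in `[a, b]) f x + \int[leb]_(x in `[b, c]) f x.
Proof.
move=> ab bc cf; have fi := continuous_integrable a c cf.
have := @Rintegral_itvB R f (BLeft a) (BRight c) b fi.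
rewrite !bnd_simp => /(_ ab bc) /eqP; rewrite subr_eq => /eqP ->.
rewrite addrC Rintegral_itv_obnd_cbnd//.
apply: integrableS fi => // x /=; rewrite !in_itv/= => /andP[/ltW bx ->].
by rewrite (le_trans ab bx).
Qed.

Definition pos_part x : R := Num.max 0 x.

Lemma pos_part_ge0 x : 0 <= x -> pos_part x = x.
Proof. by rewrite /pos_part; case: ltgtP. Qed.

Lemma pos_part_le0 x : x <= 0 -> pos_part x = 0.
Proof. by rewrite /pos_part; case: ltgtP. Qed.

Lemma continuous_pos_part : continuous pos_part.
Proof.
move=> x; apply: (@continuous_max R R (cst 0) id x); first exact: cvg_cst.
exact: cvg_id.
Qed.

(** The only delicate point is [0], where the difference quotient is
    [pos_part h]. *)
Lemma is_derive_pos_part2 x :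
  is_derive x 1 (fun y => pos_part y ^+ 2) (2 * pos_part x).
Proof.
have [x0|x0|->] := ltgtP x 0.
- apply: (@is_derive_local (fun=> 0) _ x (x - 1) 0).
  + by rewrite x0 gtrBl ltr01.
  + by move=> y /andP[_ y0]; rewrite pos_part_le0 ?expr0n ?ltW.
  + by rewrite pos_part_le0 ?ltW// mulr0; exact: is_derive1_const.
- apply: (@is_derive_local (fun y => y ^+ 2) _ x 0 (x + 1)).
  + by rewrite x0 ltrDl ltr01.
  + by move=> y /andP[y0 _]; rewrite pos_part_ge0 ?ltW.
  + by der; rewrite pos_part_ge0 ?ltW// expr1; ring.
- rewrite pos_part_ge0// mulr0.
  have lim0 : h^-1 *: (pos_part (h *: 1 + 0) ^+ 2 - pos_part 0 ^+ 2)
      @[h --> (0:R)^'] --> (0 : R).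
    apply: (@cvg_trans _ (pos_part h @[h --> (0:R)^'])); last first.
      have : {for (0 : R), continuous pos_part} by exact: continuous_pos_part.
      rewrite /prop_for /continuous_at [pos_part 0]pos_part_ge0// => p0.
      exact: cvg_within_filter p0.
    apply: near_eq_cvg; near=> h.
    have h0 : h != 0 by near: h; exact: nbhs_dnbhs_neq.
    rewrite (@pos_part_ge0 0)// expr0n subr0 addr0 /GRing.scale/= mulr1.
    have [hp|hn] := leP 0 h; first by rewrite pos_part_ge0// expr2 mulKf.
    by rewrite pos_part_le0 ?ltW// expr0n mulr0.
  by split; [apply/cvg_ex; exists 0|apply/cvg_lim].
Unshelve. all: by end_near. Qed.

Lemma is_derive_pos_part3 x :
  is_derive x 1 (fun y => pos_part y ^+ 3) (3 * pos_part x ^+ 2).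
Proof.
rewrite (_ : (fun y => _) = (fun y => pos_part y ^+ 2 * y)).
  have H := is_derive_pos_part2 x.
  apply: (is_derive_eq (is_derive1_mul H (is_derive1_id x))).
  have [x0|/ltW x0] := leP 0 x; [rewrite pos_part_ge0//|rewrite pos_part_le0//]; ring.
apply/funext => y.
have [x0|/ltW x0] := leP 0 y; [rewrite pos_part_ge0//|rewrite pos_part_le0//]; ring.
Qed.

End Primitives.

(** * Regularity of weak solutions *)

Section Regularity.
Context {R : realType}.
Implicit Types (f g F W phi : R -> R) (x a b p q : R).
Local Notation leb := (@lebesgue_measure R).

Lemma is_derive_unique f x (a b : R) :
  is_derive x 1 f a -> is_derive x 1 f b -> a = b.
Proof. by move=> [_ <-] [_ <-]. Qed.

(** Both [phi] and its derivative are then test functions on any interval that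
    contains [[p, q]] in its interior. *)
Definition C2_supported_in p q phi (dphi ddphi : R -> R) : Prop :=
  [/\ forall x, is_derive x 1 phi (dphi x),
      forall x, is_derive x 1 dphi (ddphi x), continuous ddphi &
      forall x, ~~ (p <= x <= q) -> phi x = 0].

Lemma C2_supported_derive p q phi dphi ddphi x :
  C2_supported_in p q phi dphi ddphi -> ~~ (p <= x <= q) -> dphi x = 0.
Proof.
move=> [d1 _ _ phi0]; rewrite negb_and -!ltNge => xpq.
apply: is_derive_unique (d1 x) _; case/orP: xpq => xpq.
  apply: (@is_derive_local _ (fun=> 0) _ x (x - 1) p).
  - by rewrite xpq gtrBl ltr01.
  - by move=> y /andP[_ yp]; rewrite phi0// negb_and -ltNge yp.

apply: (@is_derive_local _ (fun=> 0) _ x q (x + 1)).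
- by rewrite xpq ltrDl ltr01.
- by move=> y /andP[yq _]; rewrite phi0// negb_and -!ltNge yq orbT.

Qed.

Lemma test_functionI a b p q phi (dphi : R -> R) : a < p -> q < b ->
  (forall x, is_derive x 1 phi (dphi x)) -> continuous dphi ->
  (forall x, ~~ (p <= x <= q) -> phi x = 0) -> test_function a b phi.
Proof.
move=> ap qb d1 cd phi0.
have sub : closure [set x | phi x != 0] `<=` `[p, q].
  rewrite closureE => x; apply; split; first exact: itv_closed.
  move=> y /=; apply: contraNT => ypq; apply/eqP/phi0.
  by move: ypq; rewrite in_itv.
split.
- by move=> x; case: (d1 x).
- by rewrite (_ : derive1 phi = dphi)//; apply/funext => x; apply: is_derive1E.
- apply: (subclosed_compact _ (@segment_compact _ p q)) => //.
  exact: closed_closure.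
- move=> x /sub /=; rewrite !in_itv/= => /andP[px xq].
  by rewrite (lt_le_trans ap)// (le_lt_trans xq).
Qed.

Lemma test_function_eq0 a b phi x : test_function a b phi ->
  ~~ (a < x < b) -> phi x = 0.
Proof.
move=> [_ _ _ sub] xab; apply/eqP; apply: contraNT xab => xn.
have : closure [set x | phi x != 0] x by apply: subset_closure.
by move/sub; rewrite /= in_itv.
Qed.

(** The point [t] against four nodes [n1], ..., [n4] weighted by [l1], ..., [l4]; with
    the values of the Lagrange basis at [t] as weights, the terms cancel to the left
    of all the nodes, since a cubic polynomial equals its interpolant. *)
Definition spline (m : nat) (t n1 n2 n3 n4 l1 l2 l3 l4 : R) x : R :=
  pos_part (t - x) ^+ m - l1 * pos_part (n1 - x) ^+ m
  - l2 * pos_part (n2 - x) ^+ m - l3 * pos_part (n3 - x) ^+ m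
  - l4 * pos_part (n4 - x) ^+ m.

Lemma is_derive_trunc3 t x :
  is_derive x 1 (fun y => pos_part (t - y) ^+ 3) (- 3 * pos_part (t - x) ^+ 2).
Proof.
have H : is_derive x 1 (fun y => t - y) (- 1).
  by der; rewrite add0r.
apply: (is_derive_eq (is_derive1_compose H (is_derive_pos_part3 (t - x)))).
ring.
Qed.

Lemma is_derive_trunc2 t x :
  is_derive x 1 (fun y => pos_part (t - y) ^+ 2) (- 2 * pos_part (t - x)).
Proof.
have H : is_derive x 1 (fun y => t - y) (- 1).
  by der; rewrite add0r.
apply: (is_derive_eq (is_derive1_compose H (is_derive_pos_part2 (t - x)))).
ring.
Qed.

Lemma continuous_trunc t : continuous (fun x => pos_part (t - x)).
Proof.
move=> x; apply: (@continuous_comp _ _ _ (fun y => t - y) pos_part x).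
  by apply: cvgB; [exact: cvg_cst|exact: cvg_id].
exact: continuous_pos_part.
Qed.

Lemma lagrange_spline_C2 (t H : R) (s := 5 / H * t) : 0 < t < H ->
  let l1 := - (s ^+ 3 - 9 * s ^+ 2 + 26 * s - 24) / 6 in
  let l2 := (s ^+ 3 - 8 * s ^+ 2 + 19 * s - 12) / 2 in
  let l3 := - (s ^+ 3 - 7 * s ^+ 2 + 14 * s - 8) / 2 in
  let l4 := (s ^+ 3 - 6 * s ^+ 2 + 11 * s - 6) / 6 in
  let S m := spline m t (H / 5) (2 * H / 5) (3 * H / 5) (4 * H / 5) l1 l2 l3 l4 in
  exists p q : R, [/\ 0 < p, q < H &
    C2_supported_in p q (S 3) (fun x => - 3 * S 2 x) (fun x => 6 * S 1 x)].
Proof.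
move=> tH l1 l2 l3 l4 S.
exists (Num.min t (H / 5)), (Num.max t (4 * H / 5)).
have H0 : 0 < H by lra.
split; first by rewrite lt_min; lra.
  by rewrite gt_max; lra.
split.
- move=> x; rewrite /S /spline; have H1 := is_derive_trunc3.
  by der; ring.
- move=> x; rewrite /S /spline; have H1 := is_derive_trunc2.
  by der; rewrite !expr1; ring.
- move=> x; rewrite /S /spline.
  have cP n : pos_part (n - y) ^+ 1 @[y --> x] --> pos_part (n - x) ^+ 1.
    by rewrite expr1; apply: continuous_trunc.
  apply: cvgM; first exact: cvg_cst.
  do 4!(apply: cvgB; last by apply: cvgM; [exact: cvg_cst|exact: cP]).
  exact: cP.
- move=> x; rewrite negb_and -!ltNge lt_min gt_max => /orP[/andP[xt xH]|/andP[xt xH]].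
    rewrite /S /spline !pos_part_ge0; try lra.
    rewrite /l1 /l2 /l3 /l4 /s; field; lra.
  by rewrite /S /spline !pos_part_le0; lra.
Qed.

Lemma Rintegral_subZ f g (c : R) a b : continuous f -> continuous g ->
  \int[leb]_(x in `[a, b]) (f x - c * g x) =
  \int[leb]_(x in `[a, b]) f x - c * \int[leb]_(x in `[a, b]) g x.
Proof.
move=> cf cg; rewrite RintegralB//; last 2 first.
- exact: continuous_integrable.
- apply: (@continuous_integrable _ (fun x => c * g x)) => x.
  by apply: cvgM; [exact: cvg_cst|exact: cg].
by rewrite RintegralZl//; exact: continuous_integrable.
Qed.

(** Integrated against [W], the function [(t - x)_+] gives the second primitive
    [W2 t], up to an affine function of [t]; since it is also the second derivative
    of [(t - x)_+^3 / 6], testing with [spline] says that [W2] equals its cubic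
    Lagrange interpolant at every point. So [W2] is a cubic polynomial, and its
    second derivative [W] is affine. *)
Lemma weak_affine (H : R) W : 0 < H -> continuous W ->
  (forall p q phi (dphi ddphi : R -> R), 0 < p -> q < H ->
    C2_supported_in p q phi dphi ddphi ->
    \int[leb]_(x in `[0, H]) (W x * ddphi x) = 0) ->
  exists A B : R, forall x, 0 < x < H -> W x = A + B * x.
Proof.
move=> H0 cW weak0.
have [W1 W1d] := primitive_exists cW.
have cW1 := derivable_continuous W1d.
have [W2 W2d] := primitive_exists cW1.
have cW2 := derivable_continuous W2d.
pose K n := W2 n - W2 0 - W1 0 * n.
have cWp n : continuous (fun x => W x * pos_part (n - x)).
  by move=> x; apply: cvgM; [exact: cW|exact: continuous_trunc].
have trunc n : 0 < n < H ->
    \int[leb]_(x in `[0, H]) (W x * pos_part (n - x)) = K n.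
  move=> /andP[n0 nH].
  rewrite (Rintegral_split (ltW n0) (ltW nH) (cWp n)).
  pose P x := W1 x * (n - x) + W2 x.
  have cP : continuous P.
    move=> x; apply: cvgD; last exact: cW2.
    apply: cvgM; first exact: cW1.
    by apply: cvgB; [exact: cvg_cst|exact: cvg_id].
  have Pd x : 0 < x < n -> is_derive x 1 P (W x * pos_part (n - x)).
    by move=> /andP[_ xn]; rewrite /P; der; rewrite pos_part_ge0; [ring|lra].
  have Zd x : n < x < H -> is_derive x 1 (fun=> 0) (W x * pos_part (n - x)).
    by move=> /andP[nx _]; der; rewrite pos_part_le0; [ring|lra].
  rewrite (Rintegral_derive n0 (cWp n) cP Pd).
  rewrite (Rintegral_derive nH (cWp n) _ Zd); last by move=> x; exact: cvg_cst.
  by rewrite /K /P; ring.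
(* The coefficients of the Lagrange interpolant at the nodes [i H / 5]. *)
pose r := 5 / H; pose k i := K (i * H / 5).
pose a0 := W2 0 + (24 * k 1 / 6 - 12 * k 2 / 2 + 8 * k 3 / 2 - 6 * k 4 / 6).
pose a1 := W1 0 + r * (- 26 * k 1 / 6 + 19 * k 2 / 2 - 14 * k 3 / 2 + 11 * k 4 / 6).
pose a2 := r ^+ 2 * (9 * k 1 / 6 - 8 * k 2 / 2 + 7 * k 3 / 2 - 6 * k 4 / 6).
pose a3 := r ^+ 3 * (- k 1 / 6 + k 2 / 2 - k 3 / 2 + k 4 / 6).
have cubic t : 0 < t < H -> W2 t = a0 + a1 * t + a2 * t ^+ 2 + a3 * t ^+ 3.
  move=> tH; have [p [q [p0 qH supp]]] := lagrange_spline_C2 tH.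
  have := weak0 _ _ _ _ _ p0 qH supp.
  rewrite -/r; set s := r * t; rewrite /spline.
  set l1 := - _ / 6; set l2 := _ / 2; set l3 := - _ / 2; set l4 := (_ - 6) / 6.
  under eq_Rintegral => x _.
    rewrite !expr1 (_ : W x * _ = 6 * (W x * pos_part (t - x))
      - (6 * l1) * (W x * pos_part (H / 5 - x))
      - (6 * l2) * (W x * pos_part (2 * H / 5 - x))
      - (6 * l3) * (W x * pos_part (3 * H / 5 - x))
      - (6 * l4) * (W x * pos_part (4 * H / 5 - x))); last by ring.
    over.
  have cB f c n : continuous f ->
      continuous (fun x => f x - c * (W x * pos_part (n - x))).
    by move=> cf x; apply: cvgB; [exact: cf|apply: cvgM; [exact: cvg_cst|exact: cWp]].
  have c6 : continuous (fun x => 6 * (W x * pos_part (t - x))).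
    by move=> x; apply: cvgM; [exact: cvg_cst|exact: cWp].
  have c1 := cB _ (6 * l1) (H / 5) c6.
  have c2 := cB _ (6 * l2) (2 * H / 5) c1.
  have c3 := cB _ (6 * l3) (3 * H / 5) c2.
  rewrite (Rintegral_subZ _ _ _ c3 (cWp _)) (Rintegral_subZ _ _ _ c2 (cWp _)).
  rewrite (Rintegral_subZ _ _ _ c1 (cWp _)) (Rintegral_subZ _ _ _ c6 (cWp _)).
  rewrite RintegralZl//; last by apply: continuous_integrable; exact: cWp.
  rewrite !trunc//; try lra.
  have k1 : K (H / 5) = k 1 by rewrite /k mul1r.
  rewrite k1 -/(k 2) -/(k 3) -/(k 4) => E.
  have Kt : K t = l1 * k 1 + l2 * k 2 + l3 * k 3 + l4 * k 4 by lra.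
  have -> : W2 t = W2 0 + W1 0 * t + K t by rewrite /K; ring.
  rewrite Kt /a0 /a1 /a2 /a3.
  by rewrite /l1 /l2 /l3 /l4 /s; field.
have quad t : 0 < t < H -> W1 t = a1 + 2 * a2 * t + 3 * a3 * t ^+ 2.
  move=> tH; apply: is_derive_unique (W2d t) _.
  apply: (@is_derive_local _
    (fun t => a0 + a1 * t + a2 * t ^+ 2 + a3 * t ^+ 3) _ t 0 H) => //.
    by move=> y yH; rewrite cubic.
  by der; ring.
exists (2 * a2), (6 * a3) => t tH; apply: is_derive_unique (W1d t) _.
apply: (@is_derive_local _ (fun t => a1 + 2 * a2 * t + 3 * a3 * t ^+ 2) _ t 0 H) => //.
  by move=> y yH; rewrite quad.
by der; ring.
Qed.

End Regularity.

Section LayeredRegularity.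
Context {R : realType}.
Implicit Types (f g F W U phi : R -> R) (x a b p q : R).
Local Notation leb := (@lebesgue_measure R).

(** The classical form of [u'' = q u], with [q] equal to [q1] on [(0, h)] and to [q2] on
    [(h, H)]; [d] stands for [u']. *)
Record layered_solution (h H q1 q2 : R) (u d : R -> R) : Prop := LayeredSolution {
  layered_cont : continuous u;
  layered_dcont : continuous d;
  layered_derive : forall x, 0 < x < H -> is_derive x 1 u (d x);
  layered_left : forall x, 0 < x < h -> is_derive x 1 d (q1 * u x);
  layered_right : forall x, h < x < H -> is_derive x 1 d (q2 * u x) }.

(** Let [F] be a second primitive of [q U]. Integrating by parts on both sides of the
    interface, [U - F] satisfies the hypothesis of [weak_affine], and [F] has the
    announced regularity. *)
Lemma weak_layered_solution (h H q1 q2 : R) U : 0 < h < H -> continuous U ->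
  (forall p q phi (dphi ddphi : R -> R), 0 < p -> q < H ->
    C2_supported_in p q phi dphi ddphi ->
    \int[leb]_(x in `[0, H]) (U x * ddphi x) =
    q1 * \int[leb]_(x in `[0, h]) (U x * phi x) +
    q2 * \int[leb]_(x in `[h, H]) (U x * phi x)) ->
  exists d, layered_solution h H q1 q2 U d.
Proof.
move=> /andP[h0 hH] cU weak; have H0 : 0 < H := lt_trans h0 hH.
have [U1 U1d] := primitive_exists cU; have cU1 := derivable_continuous U1d.
(* A continuous primitive of [q U], written so as to be continuous everywhere. *)
pose G x := q1 * (U1 (Num.min x h) - U1 h) + q2 * (U1 (Num.max x h) - U1 h).
have cG : continuous G.
  move=> x; apply: cvgD; (apply: cvgM; first exact: cvg_cst);
    apply: cvgB; try exact: cvg_cst.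
    apply: (@continuous_comp _ _ _ (fun x => Num.min x h) U1); last exact: cU1.
    by apply: (@continuous_min R R id (cst h) x); [exact: cvg_id|exact: cvg_cst].
  apply: (@continuous_comp _ _ _ (fun x => Num.max x h) U1); last exact: cU1.
  by apply: (@continuous_max R R id (cst h) x); [exact: cvg_id|exact: cvg_cst].
have Gl x : x <= h -> G x = q1 * (U1 x - U1 h).
  by move=> xh; rewrite /G min_l// max_r// subrr mulr0 addr0.
have Gr x : h <= x -> G x = q2 * (U1 x - U1 h).
  by move=> xh; rewrite /G min_r// max_l// subrr mulr0 add0r.
have [F Fd] := primitive_exists cG; have cF := derivable_continuous Fd.
have cW : continuous (fun x => U x - F x).
  by move=> x; apply: cvgB; [exact: cU|exact: cF].
have weakW p q phi dphi ddphi : 0 < p -> q < H ->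
    C2_supported_in p q phi dphi ddphi ->
    \int[leb]_(x in `[0, H]) ((U x - F x) * ddphi x) = 0.
  move=> p0 qH supp; have [phid dphid cdd phi0] := supp.
  have dphi0 x : ~~ (p <= x <= q) -> dphi x = 0.
    exact: C2_supported_derive supp.
  have cphi := derivable_continuous phid.
  have cdphi := derivable_continuous dphid.
  have cM f g : continuous f -> continuous g -> continuous (fun x => f x * g x).
    by move=> cf cg x; apply: cvgM; [exact: cf|exact: cg].
  have parts c a b : a < b ->
      (forall x, a < x < b -> G x = c * (U1 x - U1 h)) ->
      \int[leb]_(x in `[a, b]) (F x * ddphi x)
        - c * \int[leb]_(x in `[a, b]) (U x * phi x) =
      (F b * dphi b - c * (U1 b - U1 h) * phi b)
        - (F a * dphi a - c * (U1 a - U1 h) * phi a).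
    move=> ab Gc.
    rewrite -Rintegral_subZ; [|exact: cM|exact: cM].
    have Pd x : a < x < b -> is_derive x 1
        (fun x => F x * dphi x - c * (U1 x - U1 h) * phi x)
        (F x * ddphi x - c * (U x * phi x)).
      by move=> xab; der; rewrite (Gc x xab); ring.
    apply: (Rintegral_derive ab _ _ Pd).
      by move=> x; apply: cvgB; [exact: cM|apply: cvgM; [exact: cvg_cst|exact: cM]].
    move=> x; apply: cvgB; first exact: cM.
    apply: cvgM; last exact: cphi.
    apply: cvgM; first exact: cvg_cst.
    by apply: cvgB; [exact: cU1|exact: cvg_cst].
  have pl := parts q1 0 h h0; have pr := parts q2 h H hH.
  under eq_Rintegral => x _ do rewrite mulrBl -[F x * _]mul1r.
  rewrite Rintegral_subZ; [|exact: cM|exact: cM].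
  rewrite (weak _ _ _ _ _ p0 qH supp).
  rewrite (@Rintegral_split _ (fun x => F x * ddphi x) 0 h H) ?ltW//; last exact: cM.
  have ph0 : phi 0 = 0 by apply: phi0; lra.
  have phH : phi H = 0 by apply: phi0; lra.
  have dph0 : dphi 0 = 0 by apply: dphi0; lra.
  have dphH : dphi H = 0 by apply: dphi0; lra.
  move: pl pr.
  rewrite ph0 phH dph0 dphH !mulr0 !subrr !mulr0 !mul0r !subr0 sub0r => pl pr.
  have /pl {}pl : forall x, 0 < x < h -> G x = q1 * (U1 x - U1 h).
    by move=> x /andP[_ /ltW]; exact: Gl.
  have /pr {}pr : forall x, h < x < H -> G x = q2 * (U1 x - U1 h).
    by move=> x /andP[/ltW xh _]; exact: Gr.
  lra.
have [A [B WAB]] := weak_affine H0 cW weakW.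
exists (fun x => G x + B); split => //.
- by move=> x; apply: cvgD; [exact: cG|exact: cvg_cst].
- move=> x xH; apply: (@is_derive_local _ (fun x => F x + (A + B * x)) _ x 0 H) => //.
    by move=> y /WAB <-; ring.
  by der; ring.
- move=> x xh.
  apply: (@is_derive_local _ (fun x => q1 * (U1 x - U1 h) + B) _ x 0 h) => //.
    by move=> y /andP[_ /ltW yh]; rewrite Gl.
  by der; ring.
- move=> x xh.
  apply: (@is_derive_local _ (fun x => q2 * (U1 x - U1 h) + B) _ x h H) => //.
    by move=> y /andP[/ltW yh _]; rewrite Gr.
  by der; ring.
Qed.

End LayeredRegularity.

Section ModeRegularity.
Context {R : realType}.
Implicit Types (f g u U phi : R -> R) (x a b p q : R).
Local Notation leb := (@lebesgue_measure R).

(** Composing with [clamp H] extends a function on [[0, H]] to a continuous function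
    on the line, which removes the one-sided conditions at the end points. *)
Definition clamp (H x : R) : R := Num.max 0 (Num.min x H).

Lemma continuous_clamp (H : R) u : 0 < H -> {within `[0, H], continuous u} ->
  continuous (fun x : R => u (clamp H x)).
Proof.
move=> H0 /subspace_continuousP cu x.
have c01 y : `[0, H]%classic (clamp H y).
  by rewrite /= in_itv/= /clamp le_max lexx/= ge_max ltW//= ge_min lexx orbT.
have cc : clamp H y @[y --> x] --> clamp H x.
  apply: (@continuous_max R R (cst 0) (fun y => Num.min y H) x); first exact: cvg_cst.
  by apply: (@continuous_min R R id (cst H) x); [exact: cvg_id|exact: cvg_cst].
have ccw : clamp H y @[y --> x] --> within `[0, H]%classic (nbhs (clamp H x)).
  move=> A nA.
  have : nbhs x (clamp H @^-1` [set y | `[0, H]%classic y -> A y]) := cc _ nA.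
  by apply: filterS => y; apply; exact: c01.
exact: (cvg_comp _ _ ccw (cu _ (c01 x))).
Qed.

Lemma clampE (H x : R) : 0 <= x <= H -> clamp H x = x.
Proof. by move=> /andP[x0 xH]; rewrite /clamp min_l// max_r. Qed.

Lemma Rintegral_piecewise (h H c1 c2 : R) f (c : R -> R) : 0 < h < H ->
  continuous f -> (forall x, c x = if x < h then c1 else c2) ->
  measurable_fun `]0, H[ (fun x => c x * f x) /\
  \int[leb]_(x in `]0, H[) (c x * f x) =
  c1 * \int[leb]_(x in `[0, h]) f x + c2 * \int[leb]_(x in `[h, H]) f x.
Proof.
move=> /andP[h0 hH] cf cE; have H0 := lt_trans h0 hH.
have fi : leb.-integrable `]0, H[ (EFin \o f).
  apply: integrableS (continuous_integrable 0 H cf) => // x /=.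
  by rewrite !in_itv/= => /andP[/ltW -> /ltW ->].
have gE : (fun x => c x * f x) =
    (fun x => c2 * f x + (c1 - c2) * (f \_ `]-oo, h[) x).
  apply/funext => x; rewrite cE /patch mem_setE in_itv/=.
  by case: ltP => _; rewrite ?mulr0 ?addr0; ring.
have fhi : leb.-integrable `]0, H[ (EFin \o (f \_ `]-oo, h[)).
  rewrite -restrict_EFin; apply/integrable_restrict => //.
  apply: integrableS fi => //.
  by apply: measurableI.
have mf2 : measurable_fun `]0, H[ (fun x => c2 * f x + (c1 - c2) * (f \_ `]-oo, h[) x).
  apply: measurable_funD; apply: measurable_funM => //.
    by have /measurable_EFinP := measurable_int _ fi.
  by have /measurable_EFinP := measurable_int _ fhi.
split; first by rewrite gE.
rewrite gE RintegralD//; last 2 first.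
- by rewrite (_ : _ \o _ = fun x => (c2%:E * (EFin \o f) x)%E)//; exact: integrableZl.
- rewrite (_ : _ \o _ = fun x => ((c1 - c2)%:E * (EFin \o (f \_ `]-oo, h[)) x)%E)//.
  exact: integrableZl.
rewrite !RintegralZl// -Rintegral_mkcondr.
rewrite (_ : `]0, H[ `&` `]-oo, h[ = `]0, h[%classic); last first.
  apply/seteqP; split => x /=; rewrite !in_itv/=.
    by move=> [/andP[-> _]].
  by move=> /andP[-> xh]; rewrite xh (lt_trans xh hH).
rewrite !Rintegral_oo_cc// (Rintegral_split (ltW h0) (ltW hH) cf); ring.
Qed.

(** The two weak derivatives, tested against [phi'] and [phi], turn the equation into
    the equality of [int u phi''] and [int q u phi]; then [weak_layered_solution]
    applies to the continuous extension of [u]. *)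
Lemma mode_function_classical (H c1 lam : R) k u (ka := k%:R ^+ 2 * pi ^+ 2) :
  h0 < H -> mode_function H c1 k lam u ->
  exists U d, [/\ forall x, 0 <= x <= H -> U x = u x,
    layered_solution h0 H (ka - lam) (ka - lam / c1) U d,
    U 0 = 0, U H = 0 & exists2 x, 0 < x < H & U x != 0].
Proof.
move=> hH [cu u0 uH [x0 x0H ux0] [u' [u'' [[uL2 u'L2 u''L2 wu wu'] ode]]]].
have h00 : (0 : R) < h0 by rewrite /h0 invr_gt0.
have H0 : 0 < H := lt_trans h00 hH.
pose U x := u (clamp H x).
have UE x : 0 <= x <= H -> U x = u x by move=> xH; rewrite /U clampE.
have cU : continuous U by exact: continuous_clamp.
have [d Ud] : exists d, layered_solution h0 H (ka - lam) (ka - lam / c1) U d.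
  apply: weak_layered_solution => //; first by rewrite h00 hH.
  move=> p q phi dphi ddphi p0 qH supp; have [phid dphid cdd phi0] := supp.
  have dphi0 x : ~~ (p <= x <= q) -> dphi x = 0.
    exact: C2_supported_derive supp.
  have cphi := derivable_continuous phid.
  have cdphi := derivable_continuous dphid.
  have t1 : test_function 0 H dphi := test_functionI p0 qH dphid cdd dphi0.
  have t0 : test_function 0 H phi := test_functionI p0 qH phid cdphi phi0.
  have cM f g : continuous f -> continuous g -> continuous (fun x => f x * g x).
    by move=> cf cg x; apply: cvgM; [exact: cf|exact: cg].
  have E1 := wu _ t1; have E2 := wu' _ t0.
  rewrite (_ : derive1 phi = dphi) in E2; last first.
    by apply/funext => x; apply: is_derive1E.
  rewrite (_ : derive1 dphi = ddphi) in E1; last first.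
    by apply/funext => x; apply: is_derive1E.
  rewrite E2 opprK in E1.
  rewrite -(@Rintegral_oo_cc _ (fun x => U x * ddphi x)); last exact: cM.
  have -> : \int[leb]_(x in `]0, H[) (U x * ddphi x) =
      \int[leb]_(x in `]0, H[) (u x * ddphi x).
    apply: eq_Rintegral => x.
    by rewrite inE/= in_itv/= => /andP[/ltW x1 /ltW x2]; rewrite UE ?x1.
  rewrite E1.
  pose c x : R := ka - lam / coef c1 x.
  have cE x : c x = if x < h0 then ka - lam else ka - lam / c1.
    by rewrite /c /coef; case: ifP => //; rewrite divr1.
  have h0H : (0 : R) < h0 < H by rewrite h00 hH.
  have [mc <-] := Rintegral_piecewise h0H (cM _ _ cU cphi) cE.
  rewrite /Rintegral; congr fine; apply: ae_eq_integral => //.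
  - apply/measurable_EFinP; apply: measurable_funM; last first.
      by apply: measurable_funTS; exact: continuous_measurable_fun.
    have := sub_Lfun_mfun u''L2; rewrite inE/= => /measurable_restrict.
    by rewrite setTI; apply.
  - exact/measurable_EFinP.
  - apply: (@filterS _ _ (ae_filter_ringOfSetsType leb) _ _ _ ode) => x /=.
    move=> xode xH; congr EFin.
    have xH' := xH; rewrite /= in_itv/= in xH'.
    move: xH' => /andP[/ltW x1 /ltW x2].
    have := xode xH; rewrite UE ?x1// -/ka /c => /eqP.
    rewrite addr_eq0 => /eqP ->; ring.
exists U, d; split => //.
- by rewrite UE// lexx ltW.
- by rewrite UE// lexx ltW.
- exists x0; first by move: x0H; rewrite in_itv.
  by move: x0H; rewrite in_itv/= => /andP[/ltW x1 /ltW x2]; rewrite UE ?x1.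
Qed.

End ModeRegularity.

Section ModeConstruction.
Context {R : realType}.
Implicit Types (f g u U phi : R -> R) (x a b p q : R).
Local Notation leb := (@lebesgue_measure R).

Lemma inL2_bounded a b f (M : R) : a < b -> measurable_fun `]a, b[ f ->
  (forall x, a < x < b -> `|f x| <= M) -> inL2 a b f.
Proof.
move=> ab mf fM.
have mfr : measurable_fun setT (f \_ `]a, b[).
  by apply/measurable_restrict => //; rewrite setTI.
rewrite /inL2 inE; apply/andP; split; rewrite inE//=.
rewrite /finite_norm unlock /=; apply: poweR_lty.
under eq_integral => x _ do
  rewrite /= (powR_mulrn 2 (normr_ge0 _)) real_normK ?num_real//.
apply: (@le_lt_trans _ _ (\int[leb]_x ((cst (M ^+ 2) \_ `]a, b[) x)%:E)%E).
  apply: ge0_le_integral => //.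
  - by move=> x _; rewrite lee_fin; exact: sqr_ge0.
  - by apply/measurable_EFinP; exact: measurable_funX.
  - by apply/measurable_EFinP/measurable_restrict => //; rewrite setTI.
  - move=> x _; rewrite /patch; case: ifPn => xab; last by rewrite expr0n.
    have xab' : a < x < b by move: xab; rewrite inE/= in_itv.
    rewrite lee_fin -real_normK ?num_real// ler_sqr ?nnegrE//; first exact: fM.
    exact: le_trans (normr_ge0 _) (fM _ xab').
rewrite (_ : (\int[leb]_x _)%E = (\int[leb]_(x in `]a, b[) (M ^+ 2)%:E)%E); last first.
  rewrite [RHS]integral_mkcond; apply: eq_integral => x _.
  by rewrite /patch; case: ifP.
rewrite integral_cst//= lebesgue_measure_itv/= lte_fin ab.
by rewrite -EFinM ltry.
Qed.

Lemma continuous_inL2 a b f : a < b -> continuous f -> inL2 a b f.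
Proof.
move=> ab cf.
have [c _ cmax] := @EVT_max R (fun x => `|f x|) a b (ltW ab)
  (continuous_subspaceT (fun x => cvg_norm (cf x))).
apply: (@inL2_bounded _ _ _ `|f c|) => //.
  by apply: measurable_funTS; exact: continuous_measurable_fun.
by move=> x /andP[ax xb]; apply: cmax; rewrite in_itv/= !ltW.
Qed.

(** The first derivative is continuous across the interface, so integrating by parts
    on each side leaves no boundary term there. *)
Lemma layered_mode_function (H c1 lam : R) k U d (ka := k%:R ^+ 2 * pi ^+ 2) :
  h0 < H -> layered_solution h0 H (ka - lam) (ka - lam / c1) U d ->
  U 0 = 0 -> U H = 0 -> (exists2 x, 0 < x < H & U x != 0) ->
  mode_function H c1 k lam U.
Proof.
move=> hH [cU cd Ud dl dr] U0 UH [x0 x0H Ux0].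
have h00 : (0 : R) < h0 by rewrite /h0 invr_gt0.
have H0 : 0 < H := lt_trans h00 hH.
have h0H : (0 : R) < h0 < H by rewrite h00 hH.
have cM f g : continuous f -> continuous g -> continuous (fun x => f x * g x).
  by move=> cf cg x; apply: cvgM; [exact: cf|exact: cg].
pose c x : R := ka - lam / coef c1 x.
have cE x : c x = if x < h0 then ka - lam else ka - lam / c1.
  by rewrite /c /coef; case: ifP => //; rewrite divr1.
split => //; first exact: continuous_subspaceT.
  by exists x0 => //; rewrite in_itv.
exists d, (fun x => c x * U x); split; last first.
  by apply: aeW => x _; rewrite /c -/ka; ring.
have test_derive phi : test_function 0 H phi ->
    [/\ forall x, is_derive x 1 phi (derive1 phi x), continuous phi,
        continuous (derive1 phi), phi 0 = 0 & phi H = 0].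
  move=> t; have [phid cphi _ _] := t.
  have phid' x : is_derive x 1 phi (derive1 phi x).
    by apply: (DeriveDef (phid x)); rewrite derive1E.
  split => //; first exact: derivable_continuous phid'.
    by apply: test_function_eq0 t _; rewrite ltxx.
  by apply: test_function_eq0 t _; rewrite ltxx andbF.
split.
- exact: continuous_inL2.
- exact: continuous_inL2.
- have [m1 _] := Rintegral_piecewise h0H cU cE.
  have [y _ ymax] := @EVT_max R (fun x => `|U x|) 0 H (ltW H0)
    (continuous_subspaceT (fun x => cvg_norm (cU x))).
  apply: (@inL2_bounded _ _ _ ((`|ka - lam| + `|ka - lam / c1|) * `|U y|)) => //.
  move=> x /andP[x1 x2]; rewrite normrM; apply: ler_pM => //.
    by rewrite cE; case: ifP => _; rewrite ?lerDl ?lerDr.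
  by apply: ymax; rewrite in_itv/= !ltW.
- move=> phi /test_derive[phid cphi cdphi phi0 phiH].
  rewrite !Rintegral_oo_cc; [|exact: cM|exact: cM].
  apply/eqP; rewrite -subr_eq0 opprK; apply/eqP.
  rewrite -RintegralD//; [|exact/continuous_integrable/cM|exact/continuous_integrable/cM].
  have Pd x : 0 < x < H -> is_derive x 1 (fun x => U x * phi x)
     (U x * derive1 phi x + d x * phi x).
    by move=> xH; have Udx := Ud x xH; have phidx := phid x; der; ring.
  rewrite (Rintegral_derive H0 _ _ Pd).
  + by rewrite phi0 phiH !mulr0 subrr.
  + by move=> x; apply: cvgD; exact: cM.
  + exact: cM.
- move=> phi /test_derive[phid cphi cdphi phi0 phiH].
  have [_] := Rintegral_piecewise h0H (cM _ _ cU cphi) cE.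
  under [X in X = _ -> _]eq_Rintegral => x _ do rewrite mulrA.
  move=> ->.
  rewrite Rintegral_oo_cc; last exact: cM.
  rewrite (@Rintegral_split _ (fun x => d x * derive1 phi x) 0 h0 H) ?ltW//;
    last exact: cM.
  have part q a b : a < b -> (forall x, a < x < b -> is_derive x 1 d (q * U x)) ->
      \int[leb]_(x in `[a, b]) (d x * derive1 phi x)
        + q * \int[leb]_(x in `[a, b]) (U x * phi x) =
      d b * phi b - d a * phi a.
    move=> ab dd.
    rewrite -[q]opprK mulNr -Rintegral_subZ; [|exact: cM|exact: cM].
    have Pd x : a < x < b -> is_derive x 1 (fun x => d x * phi x)
       (d x * derive1 phi x - - q * (U x * phi x)).
      by move=> xH; have ddx := dd x xH; have phidx := phid x; der; ring.
    rewrite (Rintegral_derive ab _ _ Pd)//.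
    + move=> x; apply: cvgB; first exact: cM.
      by apply: cvgM; [exact: cvg_cst|exact: cM].
    + exact: cM.
  have pl := part _ _ _ h00 dl; have pr := part _ _ _ hH dr.
  move: pl pr; rewrite phi0 phiH !mulr0 => pl pr; lra.
Qed.

End ModeConstruction.

(** * Hyperbolic functions *)

Section Hyperbolic.
Context {R : realType}.
Implicit Types x y : R.

Definition sinh x : R := (expR x - expR (- x)) / 2.
Definition cosh x : R := (expR x + expR (- x)) / 2.

Lemma sinh_ge x : 0 <= x -> x <= sinh x.
Proof.
move=> x0; rewrite -subr_ge0.
pose f y := sinh y - y.
have f' y : is_derive y 1 f (cosh y - 1).
  by rewrite /f /sinh; der; rewrite /cosh; field.
have cf := derivable_continuous f'.
have -> : 0 = f 0 by rewrite /f /sinh oppr0 subrr mul0r addr0.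
apply: (@derive_ge0_ndecr _ f (fun y => cosh y - 1) 0 x) => //.
  by move=> y _; exact: cf.
move=> y _.
rewrite /cosh; have := expR_gt0 y; have := expRxMexpNx_1 y.
set a := expR y; set b := expR (- y) => ab a0.
have sq : 0 <= (a - 1) ^+ 2 by exact: sqr_ge0.
suff : 0 <= a * ((a + b) / 2 - 1) by move=> aP; rewrite -(pmulr_rge0 _ a0).
rewrite (_ : a * _ = (a ^+ 2 + a * b) / 2 - a); last by field.
rewrite ab; lra.
Qed.

Lemma cosh_gt0 x : 0 < cosh x.
Proof. by rewrite /cosh divr_gt0// addr_gt0// expR_gt0. Qed.

Lemma sinh_ge0 x : 0 <= x -> 0 <= sinh x.
Proof. by move=> x0; apply: le_trans (sinh_ge x0). Qed.

Lemma sinh_gt0 x : 0 < x -> 0 < sinh x.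
Proof. by move=> x0; apply: lt_le_trans (sinh_ge (ltW x0)). Qed.

Lemma cosh_le_expR x : 0 <= x -> cosh x <= expR x.
Proof.
move=> x0; have : expR (- x) <= expR x by rewrite ler_expR; lra.
rewrite /cosh; lra.
Qed.

(** The difference of the two sides has derivative [x sinh x]. *)
Lemma sinh_le_cosh x : 0 <= x -> sinh x <= x * cosh x.
Proof.
move=> x0; rewrite -subr_ge0.
pose f y := y * cosh y - sinh y.
have f' y : is_derive y 1 f (y * sinh y).
  by rewrite /f /sinh /cosh; der; field.
have cf := derivable_continuous f'.
have -> : 0 = f 0 by rewrite /f /sinh oppr0 subrr !mul0r oppr0 addr0.
apply: (@derive_ge0_ndecr _ f (fun y => y * sinh y) 0 x) => //.
  by move=> y _; exact: cf.
move=> y /andP[y0 _].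
by rewrite mulr_ge0 ?sinh_ge0// ltW.
Qed.

(** Because [cosh x - sinh x = exp (- x) <= 1] and [x <= sinh x]. *)
Lemma cosh_le_sinh x : 0 <= x -> x * cosh x <= (1 + x) * sinh x.
Proof.
move=> x0; have E : cosh x = sinh x + expR (- x) by rewrite /cosh /sinh; field.
have e1 : expR (- x) <= 1 by rewrite -expR0 ler_expR; lra.
have := sinh_ge x0; have := ler_wpM2l x0 e1; rewrite mulr1 E mulrDr mulrDl mul1r.
lra.
Qed.

Lemma sinh_ratio x y : 0 <= x -> 0 <= y -> sinh x * expR y <= sinh (x + y).
Proof.
move=> x0 y0; rewrite /sinh opprD !expRD.
have e : expR (- y) <= expR y by rewrite ler_expR; lra.
have := expR_gt0 (- x); move: (expR (- x)) => b b0.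
have := ler_wpM2l (ltW b0) e; lra.
Qed.

Lemma sinh_ndecr x y : 0 <= x -> x <= y -> sinh x <= sinh y.
Proof.
move=> x0 xy; have : expR x <= expR y by rewrite ler_expR.
have : expR (- y) <= expR (- x) by rewrite ler_expR lerN2.
by rewrite /sinh; lra.
Qed.

Lemma continuous_sinh : continuous sinh.
Proof.
apply: (@derivable_continuous _ sinh cosh) => x.
by rewrite /sinh; der; rewrite /cosh; field.
Qed.

Lemma continuous_cosh : continuous cosh.
Proof.
apply: (@derivable_continuous _ cosh sinh) => x.
by rewrite /cosh; der; rewrite /sinh; field.
Qed.

End Hyperbolic.

(** * Explicit form of the modes *)

Section ExplicitModes.
Context {R : realType}.
Implicit Types (f g u U d : R -> R) (x h H q al be : R).

(** [u u'] is nondecreasing and vanishes at both ends. *)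
Lemma layered_solution_eq0 h H (q1 q2 : R) U d : 0 < h < H -> 0 <= q1 -> 0 <= q2 ->
  layered_solution h H q1 q2 U d -> U 0 = 0 -> U H = 0 ->
  forall x, 0 < x < H -> U x = 0.
Proof.
move=> /andP[h0 hH] q10 q20 [cU cd Ud dl dr] U0 UH x xH.
have cP : continuous (fun x => U x * d x).
  by move=> y; apply: cvgM; [exact: cU|exact: cd].
have mono q a b : 0 <= a -> b <= H -> 0 <= q ->
    (forall x, a < x < b -> is_derive x 1 d (q * U x)) ->
    forall x y, a <= x -> x <= y -> y <= b -> U x * d x <= U y * d y.
  move=> a0 bH q0 dd.
  apply: (@derive_ge0_ndecr _ (fun x => U x * d x) (fun x => d x ^+ 2 + q * U x ^+ 2)).
    by move=> y _; exact: cP.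
    move=> y yab; have ddy := dd y yab.
    have Udy : is_derive y 1 U (d y) by apply: Ud; lra.
    by der; ring.
  by move=> y _; apply: addr_ge0; [exact: sqr_ge0|apply: mulr_ge0 => //; exact: sqr_ge0].
have ml := mono q1 0 h (lexx _) (ltW hH) q10 dl.
have mr := mono q2 h H (ltW h0) (lexx _) q20 dr.
have Ph : U h * d h = 0.
  apply/eqP; rewrite eq_le; apply/andP; split.
    by have := mr h H (lexx _) (ltW hH) (lexx _); rewrite UH mul0r.
  by have := ml 0 h (lexx _) (ltW h0) (lexx _); rewrite U0 mul0r.
have P0 y : 0 <= y <= H -> U y * d y = 0.
  move=> /andP[y0 yH]; apply/eqP; rewrite eq_le.
  have [yh|/ltW hy] := leP y h.
    have := ml y h y0 yh (lexx _); rewrite Ph => ->.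
    by have := ml 0 y (lexx _) y0 yh; rewrite U0 mul0r => ->.
  have := mr y H hy yH (lexx _); rewrite UH mul0r => ->.
  by have := mr h y (lexx _) hy yH; rewrite Ph => ->.
have E : U x ^+ 2 = U 0 ^+ 2.
  apply: (@derive0_cst _ (fun x => U x ^+ 2) 0 H); last by lra.
    by move=> y _; apply: (cvgM (cU y) (cU y)).
  move=> y yH; have Udy := Ud y yH.
  have Py : U y * d y = 0 by apply: P0; lra.
  by der; rewrite expr1 -mulrA Py mulr0.
by apply/eqP; rewrite -sqrf_eq0 E U0 expr0n.
Qed.

(** Uniqueness for the Cauchy problem, from the energy
    [(u' - v')^2 + al^2 (u - v)^2]. *)
Lemma trigonometric_solution h al U d (A := d 0 / al) : 0 < h -> al != 0 ->
  continuous U -> continuous d ->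
  (forall x, 0 < x < h -> is_derive x 1 U (d x)) ->
  (forall x, 0 < x < h -> is_derive x 1 d (- al ^+ 2 * U x)) -> U 0 = 0 ->
  forall x, 0 <= x <= h -> U x = A * sin (al * x) /\ d x = A * al * cos (al * x).
Proof.
move=> h0 al0 cU cd Ud dd U0 x xh.
pose e y := (d y - A * al * cos (al * y)) ^+ 2 + al ^+ 2 * (U y - A * sin (al * y)) ^+ 2.
have csin : continuous (fun y => A * sin (al * y)).
  apply: (@derivable_continuous _ _ (fun y => A * al * cos (al * y))) => y.
  by der; ring.
have ccos : continuous (fun y => A * al * cos (al * y)).
  apply: (@derivable_continuous _ _ (fun y => - (A * al ^+ 2 * sin (al * y)))) => y.
  by der; ring.
have ce : continuous e.
  move=> y; apply: cvgD.
    by apply: (@cvgM _ _ _ _ _ _ _ _); apply: cvgB; try exact: cd; exact: ccos.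
  apply: cvgM; first exact: cvg_cst.
  by apply: (@cvgM _ _ _ _ _ _ _ _); apply: cvgB; try exact: cU; exact: csin.
have ee : e x = e 0.
  apply: (@derive0_cst _ e 0 h) => //; first by move=> y _; exact: ce.
  move=> y yh; have Uy := Ud y yh; have dy := dd y yh.
  by rewrite /e; der; rewrite /= !expr1; ring.
have e0 : e 0 = 0.
  by rewrite /e U0 !mulr0 sin0 cos0 mulr0 mulr1 /A divfK// !subrr expr0n/= mulr0 addr0.
move: ee; rewrite e0 /e -exprMn => /eqP; rewrite paddr_eq0 ?sqr_ge0// !sqrf_eq0.
by rewrite mulf_eq0 (negbTE al0)/= !subr_eq0 => /andP[/eqP -> /eqP ->].
Qed.

(** For [s] equal to [be] or [- be], the product of [u' + s u] by [exp (- s x)] is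
    constant. *)
Lemma hyperbolic_solution h H be U d (B := - d H / be) : h < H -> be != 0 ->
  continuous U -> continuous d ->
  (forall x, h < x < H -> is_derive x 1 U (d x)) ->
  (forall x, h < x < H -> is_derive x 1 d (be ^+ 2 * U x)) -> U H = 0 ->
  forall x, h <= x <= H ->
    U x = B * sinh (be * (H - x)) /\ d x = - (B * be * cosh (be * (H - x))).
Proof.
move=> hH be0 cU cd Ud dd UH x xH.
have expo s : s ^+ 2 = be ^+ 2 -> d x + s * U x = d H * expR (s * (x - H)).
  move=> s2; pose e y := (d y + s * U y) * expR (- (s * y)).
  have cexp : continuous (fun y => expR (- (s * y))).
    apply: (@derivable_continuous _ _ (fun y => - (s * expR (- (s * y))))) => y.
    by der; ring.
  have ce : continuous e.
    move=> y; apply: cvgM; last exact: cexp.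
    by apply: cvgD; [exact: cd|apply: cvgM; [exact: cvg_cst|exact: cU]].
  have ec y : h <= y <= H -> e y = e h.
    apply: derive0_cst => //; first by move=> z _; exact: ce.
    move=> z zH; have Uz := Ud z zH; have dz := dd z zH.
    by rewrite /e; der; rewrite -s2; ring.
  have : e x = e H by rewrite ec// ec// lexx ltW.
  rewrite /e UH mulr0 addr0 => E.
  rewrite mulrBr expRD mulrCA -E mulrCA -expRD subrr expR0 mulr1.
  by [].
have Ep := expo be (erefl _); have Em := expo (- be) (sqrrN _).
have e1 : be * (H - x) = - be * (x - H) by ring.
have e2 : - (be * (H - x)) = be * (x - H) by ring.
rewrite /sinh /cosh e2 e1 /B.
move: Ep Em; set E1 := expR (be * _); set E2 := expR (- be * _) => Ep Em; split.
  apply: (mulfI be0); rewrite (_ : be * (_ * _) = (d H * E1 - d H * E2) / 2); last by field.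
  by rewrite -Ep -Em; field.
rewrite [RHS](_ : _ = (d H * E1 + d H * E2) / 2); last by field.
by rewrite -Ep -Em; field.
Qed.

End ExplicitModes.

(** * The dispersion relation *)

Section Dispersion.
Context {R : realType}.
Implicit Types (u U d : R -> R) (x h H al be lam ka L : R).

(** The determinant of the two matching conditions at [h0] (equality of the values
    and of the derivatives) between [A sin (al x)] and [B sinh (be (H - x))]. *)
Definition dispersion L al be : R :=
  al * cos (al * h0) * sinh (be * L) + be * sin (al * h0) * cosh (be * L).

Lemma h0_gt0 : (0 : R) < h0.
Proof. by rewrite /h0 invr_gt0. Qed.

(** Up to [k^2 pi^2] the coefficient [q] in [u'' = q u] is nonnegative in both layers,
    so [layered_solution_eq0] applies. *)
Lemma mode_eigenvalue_gt H (c1 lam : R) k u : h0 < H -> 1 < c1 ->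
  mode_function H c1 k lam u -> k%:R ^+ 2 * pi ^+ 2 < lam.
Proof.
move=> hH c11 /(mode_function_classical hH)[U [d [_ sol U0 UH [x xH Ux]]]].
rewrite ltNge; apply/negP => lamka; move/negP: Ux; apply; apply/eqP.
have h0H : (0 : R) < h0 < H by rewrite h0_gt0 hH.
apply: (layered_solution_eq0 h0H _ _ sol) => //; first by rewrite subr_ge0.
have c10 : 0 < c1 by lra.
have [lam0|/ltW lam0] := leP 0 lam.
  rewrite subr_ge0; apply: le_trans lamka; rewrite ler_pdivrMr//.
  by rewrite ler_peMr// ltW.
rewrite subr_ge0; apply: (@le_trans _ _ 0).
  by rewrite pmulr_lle0 ?invr_gt0.
by rewrite mulr_ge0// sqr_ge0.
Qed.

Lemma guided_mode_form H (c1 lam : R) k u (ka := k%:R ^+ 2 * pi ^+ 2) (L := H - h0) :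
  h0 < H -> 1 < c1 -> mode_function H c1 k lam u -> ka < lam < c1 * ka ->
  exists al be A B : R,
    [/\ [/\ 0 < al, 0 < be, al ^+ 2 = lam - ka & be ^+ 2 = ka - lam / c1],
        forall x, 0 <= x <= h0 -> u x = A * sin (al * x),
        forall x, h0 <= x <= H -> u x = B * sinh (be * (H - x)),
        [/\ A * sin (al * h0) = B * sinh (be * L) &
          A * al * cos (al * h0) = - (B * be * cosh (be * L))] &
        dispersion L al be = 0].
Proof.
move=> hH c11 /(mode_function_classical hH)[U [d [Uu sol U0 UH [x0 xH Ux]]]].
move=> /andP[kalam lamka].
have h00 := h0_gt0; have H0 : 0 < H := lt_trans h00 hH.
have c10 : 0 < c1 by lra.
have q1 : 0 < lam - ka by rewrite subr_gt0.
have q2 : 0 < ka - lam / c1 by rewrite subr_gt0 ltr_pdivrMr// mulrC.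
pose al := Num.sqrt (lam - ka); pose be := Num.sqrt (ka - lam / c1).
have al0 : 0 < al by rewrite sqrtr_gt0.
have be0 : 0 < be by rewrite sqrtr_gt0.
have al2 : al ^+ 2 = lam - ka by rewrite sqr_sqrtr ?ltW.
have be2 : be ^+ 2 = ka - lam / c1 by rewrite sqr_sqrtr ?ltW.
case: sol => cU cd Ud dl dr.
have al_neq0 : al != 0 by rewrite gt_eqF.
have be_neq0 : be != 0 by rewrite gt_eqF.
have Ul := @trigonometric_solution _ h0 al U d h00 al_neq0 cU cd.
have {}Ul x : 0 <= x <= h0 ->
    U x = d 0 / al * sin (al * x) /\ d x = d 0 / al * al * cos (al * x).
  apply: Ul => //.
    by move=> y yh; apply: Ud; lra.
  by move=> y yh; rewrite al2 opprB; exact: dl.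
have Ur := @hyperbolic_solution _ h0 H be U d hH be_neq0 cU cd.
have {}Ur x : h0 <= x <= H -> U x = - d H / be * sinh (be * (H - x)) /\
    d x = - (- d H / be * be * cosh (be * (H - x))).
  apply: Ur => //.
    by move=> y yh; apply: Ud; lra.
  by move=> y yh; rewrite be2; exact: dr.
move: (d 0 / al) (- d H / be) Ul Ur => A B Ul Ur.
have h0l : (0 : R) <= (h0 : R) <= (h0 : R) by rewrite lexx ltW.
have h0r : (h0 : R) <= (h0 : R) <= H by rewrite lexx ltW.
have [U1 d1] := Ul _ h0l; have [U2 d2] := Ur _ h0r.
have match1 : A * sin (al * h0) = B * sinh (be * L) by rewrite -U1 U2.
have match2 : A * al * cos (al * h0) = - (B * be * cosh (be * L)) by rewrite -d1 d2.
exists al, be, A, B; split => //.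
- by move=> x xh; have [<- _] := Ul _ xh; rewrite Uu//; lra.
- by move=> x xh; have [<- _] := Ur _ xh; rewrite Uu//; lra.
have [A0|A_neq0] := eqVneq A 0.
  have sinh_neq0 : sinh (be * L) != 0 by rewrite gt_eqF// sinh_gt0// mulr_gt0// subr_gt0.
  have B0 : B = 0.
    apply/eqP; move/eqP: match1; rewrite A0 mul0r eq_sym mulf_eq0.
    by rewrite (negbTE sinh_neq0) orbF.
  move/negP: Ux; case; apply/eqP.
  have [xh|/ltW hx] := leP x0 h0.
    by have [-> _] := Ul x0 ltac:(lra); rewrite A0 mul0r.
  by have [-> _] := Ur x0 ltac:(lra); rewrite B0 mul0r.
apply: (mulfI A_neq0); rewrite mulr0 /dispersion.
rewrite (_ : A * _ = (A * al * cos (al * h0)) * sinh (be * L)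
  + be * (A * sin (al * h0)) * cosh (be * L)); last by ring.
by rewrite match1 match2; ring.
Qed.

(** The derivative [d] is prescribed by gluing the two explicit expressions, and
    the mode is defined as its primitive, so that it is [C^1] by construction; the
    equality of the values at [h0] then identifies it in the cladding. *)
Lemma dispersion_mode H (c1 lam : R) k al be (ka := k%:R ^+ 2 * pi ^+ 2) (L := H - h0) :
  h0 < H -> 0 < al -> 0 < be -> al ^+ 2 = lam - ka -> be ^+ 2 = ka - lam / c1 ->
  dispersion L al be = 0 -> mode_spectrum H c1 k lam.
Proof.
move=> hH al0 be0 al2 be2 disp.
have h00 := h0_gt0; have H0 : 0 < H := lt_trans h00 hH.
pose A := sinh (be * L); pose B := sin (al * h0).
have match2 : A * al * cos (al * h0) = - (B * be * cosh (be * L)).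
  apply/eqP; rewrite -subr_eq0 opprK -[X in _ == X]disp /dispersion; apply/eqP.
  by rewrite /A /B; ring.
have ccos : continuous (fun x => A * al * cos (al * x)).
  apply: (@derivable_continuous _ _ (fun y => - (A * al ^+ 2 * sin (al * y)))) => y.
  by der; ring.
have ccosh : continuous (fun x => - (B * be * cosh (be * (H - x)))).
  apply: (@derivable_continuous _ _ (fun y => B * be ^+ 2 * sinh (be * (H - y)))) => y.
  by rewrite /cosh; der; rewrite /sinh; field.
pose d x := A * al * cos (al * Num.min x h0) +
  (- (B * be * cosh (be * (H - Num.max x h0))) - A * al * cos (al * h0)).
have cd : continuous d.
  move=> x; apply: cvgD.
    apply: (@continuous_comp _ _ _ (fun x => Num.min x h0)
      (fun x => A * al * cos (al * x))); last exact: ccos.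
    by apply: (@continuous_min R R id (cst h0) x); [exact: cvg_id|exact: cvg_cst].
  apply: cvgB; last exact: cvg_cst.
  apply: (@continuous_comp _ _ _ (fun x => Num.max x h0)
    (fun x => - (B * be * cosh (be * (H - x))))); last exact: ccosh.
  by apply: (@continuous_max R R id (cst h0) x); [exact: cvg_id|exact: cvg_cst].
have dl x : x <= h0 -> d x = A * al * cos (al * x).
  by move=> xh; rewrite /d min_l// max_r// -match2 subrr addr0.
have dr x : h0 <= x -> d x = - (B * be * cosh (be * (H - x))).
  by move=> xh; rewrite /d min_r// max_l// addrC subrK.
have [F Fd] := primitive_exists cd.
pose U x := F x - F 0.
have Ud x : is_derive x 1 U (d x) by rewrite /U; have Fx := Fd x; der; rewrite addr0.
have cU := derivable_continuous Ud.
have U0 : U 0 = 0 by rewrite /U subrr.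
have sinl (y : R) : is_derive y 1 (fun x => A * sin (al * x)) (A * al * cos (al * y)).
  by der; ring.
have csin := derivable_continuous sinl.
have sinhr (y : R) : is_derive y 1 (fun x => B * sinh (be * (H - x)))
    (- (B * be * cosh (be * (H - y)))).
  by rewrite /sinh; der; rewrite /cosh; field.
have csinh := derivable_continuous sinhr.
have Ul x : 0 <= x <= h0 -> U x = A * sin (al * x).
  move=> xh; apply/eqP; rewrite -subr_eq0; apply/eqP.
  have := @derive_eq_const _ U (fun x => A * sin (al * x)) d 0 h0
    (fun y _ => cU y) (fun y _ => csin y) (fun y _ => Ud y).
  rewrite U0 mulr0 sin0 mulr0 subrr; apply => // y /andP[_ /ltW yh].
  by rewrite dl.
have Uh : U h0 = B * sinh (be * L).
  by rewrite Ul ?lexx ?ltW// /A /B mulrC.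
have Ur x : h0 <= x <= H -> U x = B * sinh (be * (H - x)).
  move=> xh; apply/eqP; rewrite -subr_eq0; apply/eqP.
  have := @derive_eq_const _ U (fun x => B * sinh (be * (H - x))) d h0 H
    (fun y _ => cU y) (fun y _ => csinh y) (fun y _ => Ud y).
  rewrite Uh subrr; apply => // y /andP[/ltW yh _].
  by rewrite dr.
have UH : U H = 0 by rewrite Ur ?lexx ?ltW// subrr mulr0 /sinh oppr0 subrr mul0r mulr0.
have sol : layered_solution h0 H (ka - lam) (ka - lam / c1) U d.
  split; [exact: cU|exact: cd|by move=> x _; exact: Ud| |].
  - move=> x xh; rewrite -opprB -al2 Ul; last by lra.
    apply: (@is_derive_local _ (fun x => A * al * cos (al * x)) _ x 0 h0) => //.
      by move=> y /andP[_ /ltW yh]; rewrite dl.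
    by der; ring.
  - move=> x xh; rewrite -be2 Ur; last by lra.
    apply: (@is_derive_local _ (fun x => - (B * be * cosh (be * (H - x)))) _ x h0 H) => //.
      by move=> y /andP[/ltW yh _]; rewrite dr.
    by rewrite /cosh; der; rewrite /sinh; field.
exists U; apply: (layered_mode_function hH sol U0 UH).
have x1 : h0 / (1 + al) < h0 by rewrite ltr_pdivrMr ?ltr_pMr// ?ltrDl//; lra.
have x0 : 0 < h0 / (1 + al) by rewrite divr_gt0//; lra.
(* A point [x < h0] with [0 < al x < pi]. *)
exists (h0 / (1 + al)); first by rewrite x0 (lt_trans x1).
rewrite Ul; last by lra.
rewrite mulf_neq0//; first by rewrite gt_eqF// sinh_gt0// mulr_gt0// subr_gt0.
rewrite gt_eqF// sin_gt0_pi// mulr_gt0//=.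
apply: (@lt_le_trans _ _ 1); last by apply: le_trans (pi_ge2 R); lra.
rewrite mulrA ltr_pdivrMr; last by lra.
by rewrite /h0; lra.
Qed.

End Dispersion.

Section DispersionRoots.
Context {R : realType}.
Implicit Types (x al be L : R).

Lemma sin_natpiD (m : nat) x : sin (m%:R * pi + x) = (-1) ^+ m * sin x.
Proof.
elim: m => [|m IH]; first by rewrite mul0r add0r mul1r.
by rewrite -natr1 mulrDl mul1r addrAC sinDpi IH exprS -mulrA mulN1r.
Qed.

Lemma cos_natpiD (m : nat) x : cos (m%:R * pi + x) = (-1) ^+ m * cos x.
Proof.
elim: m => [|m IH]; first by rewrite mul0r add0r mul1r.
by rewrite -natr1 mulrDl mul1r addrAC cosDpi IH exprS -mulrA mulN1r.
Qed.

(** For [al <= pi] both terms of the dispersion relation are nonnegative and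
    the second one is positive. *)
Lemma dispersion_root_gt_pi L al be : 0 < L -> 0 < al -> 0 < be ->
  dispersion L al be = 0 -> pi < al.
Proof.
move=> L0 al0 be0 disp; rewrite ltNge; apply/negP => alpi.
have x0 : 0 < be * L by rewrite mulr_gt0.
have := pi_gt0 R => pi0.
have s0 : 0 < sin (al * h0) by apply: sin_gt0_pi; rewrite /h0; lra.
have c0 : 0 <= cos (al * h0) by apply: cos_ge0_pihalf; rewrite /h0; lra.
have : 0 < dispersion L al be.
  rewrite /dispersion ltr_wpDl//.
    apply: mulr_ge0; last by apply: sinh_ge0; exact: ltW.
    by apply: mulr_ge0 => //; exact: ltW.
  by apply: mulr_gt0; [exact: mulr_gt0|exact: cosh_gt0].
by rewrite disp ltxx.
Qed.

Lemma dispersion_shift (m : nat) L al be eta : al = 2 * (m%:R * pi - eta) ->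
  dispersion L al be =
  (-1) ^+ m * (al * cos eta * sinh (be * L) - be * sin eta * cosh (be * L)).
Proof.
move=> alE; have E : al * h0 = m%:R * pi + - eta by rewrite alE /h0; field.
by rewrite /dispersion E sin_natpiD cos_natpiD cosN sinN; ring.
Qed.

(** Intermediate values in [eta], for [al = 2 (m pi - eta)]. The remaining factor [G] is
    negative at [pi / 2]. At [eta = 0] it may vanish together with [be], when
    [amax = 2 m pi]; but [x <= sinh x] gives [G >= be E], where [E] is continuous and
    [E 0 = 2 m pi L] is positive. *)
Lemma dispersion_root_exists (m : nat) L (c1 amax : R) :
  (1 <= m)%N -> 0 < L -> 0 < c1 -> 2 * (m%:R * pi) <= amax ->
  exists al be, [/\ 0 < al < amax, 0 < be, 2 * (m%:R * pi) - pi <= al,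
     c1 * be ^+ 2 = amax ^+ 2 - al ^+ 2 & dispersion L al be = 0].
Proof.
move=> m1 L0 c10 ma; have pi0 := pi_gt0 R.
have mpi : pi <= m%:R * pi :> R by rewrite ler_peMl ?(ltW pi0)// ler1n.
set M := m%:R * pi : R in ma mpi *.
pose a eta := 2 * (M - eta).
pose b eta := Num.sqrt ((amax ^+ 2 - a eta ^+ 2) / c1).
pose G eta := a eta * cos eta * sinh (b eta * L) - b eta * sin eta * cosh (b eta * L).
pose E eta := a eta * L * cos eta - sin eta * cosh (b eta * L).
have b2 eta : 0 < eta < pi -> 0 < b eta /\ c1 * b eta ^+ 2 = amax ^+ 2 - a eta ^+ 2.
  move=> eta0.
  have d0 : 0 < amax ^+ 2 - a eta ^+ 2.
    by rewrite subr_sqr mulr_gt0// /a; lra.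
  have d1 : 0 < (amax ^+ 2 - a eta ^+ 2) / c1 by rewrite divr_gt0.
  split; first by rewrite sqrtr_gt0.
  by rewrite sqr_sqrtr ?ltW// mulrC divfK// gt_eqF.
have ca : continuous a.
  by move=> x; apply: is_derive_continuous; rewrite /a; der.
have cb : continuous b.
  move=> x; apply: (@continuous_comp _ _ _
    (fun e => (amax ^+ 2 - a e ^+ 2) / c1) (@Num.sqrt R) x).
    by apply: is_derive_continuous; rewrite /a; der.
  exact: sqrt_continuous.
have cbL : continuous (fun e => b e * L).
  by move=> x; apply: cvgM; [exact: cb|exact: cvg_cst].
have csh : continuous (fun e => sinh (b e * L)).
  move=> x; apply: (@continuous_comp _ _ _ (fun e => b e * L) (@sinh R) x).
    exact: cbL.
  exact: continuous_sinh.
have cch : continuous (fun e => cosh (b e * L)).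
  move=> x; apply: (@continuous_comp _ _ _ (fun e => b e * L) (@cosh R) x).
    exact: cbL.
  exact: continuous_cosh.
have cG : continuous G.
  move=> x; apply: cvgB.
    apply: cvgM; last exact: csh.
    by apply: cvgM; [exact: ca|exact: continuous_cos].
  apply: cvgM; last exact: cch.
  by apply: cvgM; [exact: cb|exact: continuous_sin].
have cE : continuous E.
  move=> x; apply: cvgB.
    apply: cvgM; last exact: continuous_cos.
    by apply: cvgM; [exact: ca|exact: cvg_cst].
  by apply: cvgM; [exact: continuous_sin|exact: cch].
have E0 : 0 < E 0.
  by rewrite /E /a sin0 cos0 mul0r !subr0 mulr1; apply: mulr_gt0 => //; lra.
have [e1 e1p E1] : exists2 e, 0 < e < pi / 2 & 0 < E e.
  have : \forall e \near (0 : R)^'+, 0 < e < pi / 2 /\ 0 < E e.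
    near=> e; split; last first.
      near: e; apply: (cvgr_gt (E 0)) => //.
      by apply: cvg_at_right_filter; exact: cE.
    apply/andP; split; first by near: e; exact: nbhs_right_gt.
    by near: e; apply: nbhs_right_lt; rewrite divr_gt0.
  by move=> /filter_ex[e [? ?]]; exists e.
have [be1 _] : 0 < b e1 /\ _ := b2 e1 ltac:(lra).
have [beh _] : 0 < b (pi / 2) /\ _ := b2 (pi / 2) ltac:(lra).
have G1 : 0 < G e1.
  have ce1 : 0 < cos e1 by apply: cos_gt0_pihalf; lra.
  have sh := sinh_ge (ltW (mulr_gt0 be1 L0)).
  apply: (@lt_le_trans _ _ (b e1 * E e1)); first by rewrite mulr_gt0.
  have ac : 0 <= a e1 * cos e1 by rewrite mulr_ge0 ?(ltW ce1)// /a; lra.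
  have := ler_wpM2l ac sh.
  rewrite /E /G; lra.
have Gh : G (pi / 2) < 0.
  rewrite /G cos_pihalf sin_pihalf mulr0 mul0r sub0r oppr_lt0 mulr1.
  by rewrite mulr_gt0// cosh_gt0.
have [e ein Ge0] : exists2 e, e \in `[e1, pi / 2] & G e = 0.
  apply: (@IVT R G e1 (pi / 2) 0); first by lra.
    exact: continuous_subspaceT.
  by rewrite ge_min le_max (ltW Gh) (ltW G1) orbT.
move: ein; rewrite in_itv/= => /andP[ee1 eh].
have [be2 bE] : 0 < b e /\ _ := b2 e ltac:(lra).
exists (a e), (b e); split => //.
- by rewrite /a; lra.
- by rewrite /a; lra.
- by rewrite (@dispersion_shift m _ _ _ e)// -/(G e) Ge0 mulr0.
Unshelve. all: by end_near. Qed.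

Lemma sin_le_id x : 0 <= x -> sin x <= x.
Proof.
move=> x0; rewrite -subr_ge0; pose f y : R := y - sin y.
have f' (y : R) : is_derive y 1 f (1 - cos y) by rewrite /f; der; ring.
have cf := derivable_continuous f'.
have -> : 0 = f 0 by rewrite /f sin0 subr0.
apply: (@derive_ge0_ndecr _ f (fun y => 1 - cos y) 0 x).
- by move=> y _; exact: cf.
- by move=> y _; rewrite subr_ge0 cos_le1.
- exact: lexx.
- exact: x0.
- exact: lexx.
Qed.

(** Write [al = 2 (n pi - eta)]. For [eta <= 0] the two terms of the dispersion
    relation have the same sign. For [eta > 0] the relation reads
    [tan eta = al tanh (be L) / be], and the right-hand side is at least
    [L / (1 + L)], because [tanh x / x >= 1 / (1 + x)] and, if the gap is small,
    [be <= al] and [1 <= al]. *)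
Lemma dispersion_root_gap (n : nat) L (c1 amax rho al be : R) :
  0 < L -> 1 < c1 -> 0 < al -> 0 < be ->
  amax = 2 * ((n%:R + rho) * pi) -> 0 <= rho <= 2^-1 ->
  c1 * be ^+ 2 = amax ^+ 2 - al ^+ 2 -> dispersion L al be = 0 ->
  L / (3 * (1 + L)) <= amax - al.
Proof.
move=> L0 c11 al0 be0 amaxE rhoP be2 disp; rewrite leNgt; apply/negP => gap.
have L1 : 0 < 1 + L by lra.
have tau3 : L / (3 * (1 + L)) < 3^-1.
  rewrite ltr_pdivrMr; last by lra.
  by lra.
have pi2 := pi_ge2 R; have pi0 := pi_gt0 R.
have alamax : al < amax.
  have : 0 < amax ^+ 2 - al ^+ 2 by rewrite -be2 mulr_gt0 ?exprn_gt0//; lra.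
  rewrite subr_gt0 ltr_pXn2r// ?nnegrE ?(ltW al0)//.
  rewrite amaxE mulr_ge0// mulr_ge0 ?(ltW pi0)// addr_ge0//; lra.
have rhopi : 0 <= rho * pi <= pi / 2.
  apply/andP; split; first by rewrite mulr_ge0//; lra.
  have : rho * pi <= 2^-1 * pi by rewrite ler_wpM2r//; lra.
  lra.
pose eta := n%:R * pi - al / 2.
have alE : al = 2 * (n%:R * pi - eta) by rewrite /eta; field.
have etaE : eta = (amax - al) / 2 - rho * pi by rewrite /eta amaxE; field.
have := disp; rewrite (dispersion_shift _ _ alE) => /eqP.
rewrite mulf_eq0 signr_eq0/= subr_eq0 => /eqP disp'.
have x0 : 0 < be * L by rewrite mulr_gt0.
have sh0 := sinh_gt0 x0; have ch0 := cosh_gt0 (be * L).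
have c0 : 0 < cos eta by apply: cos_gt0_pihalf; rewrite etaE; lra.
have lhs0 : 0 < al * cos eta * sinh (be * L).
  by apply: mulr_gt0 => //; exact: mulr_gt0.
have [eta0|eta0] := leP eta 0.
  have s0 : sin eta <= 0.
    by rewrite -oppr_ge0 -sinN; apply: sin_ge0_pi; rewrite etaE; lra.
  have : be * sin eta * cosh (be * L) <= 0.
    by rewrite pmulr_lle0// pmulr_rle0.
  by rewrite -disp'; lra.
have eta6 : eta < 6^-1 by rewrite etaE; lra.
have n1 : 1 <= n%:R :> R.
  rewrite ler1n lt0n; apply/eqP => n0; move: alE; rewrite n0 mul0r; lra.
have npi : 2 <= n%:R * pi :> R.
  have : 1 * pi <= n%:R * pi :> R by rewrite ler_wpM2r// ltW.
  lra.
have al1 : 1 <= al by rewrite alE; lra.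
have beal : be <= al.
  rewrite -(@ler_pXn2r _ 2)// ?nnegrE ?(ltW be0) ?(ltW al0)//.
  have b1 : be ^+ 2 <= c1 * be ^+ 2 by rewrite ler_peMl ?sqr_ge0// ltW.
  have b3 : amax ^+ 2 - al ^+ 2 <= 3^-1 * (amax + al).
    rewrite subr_sqr ler_wpM2r//; lra.
  have al2 : al <= al ^+ 2 by rewrite expr2 ler_peMl// ltW.
  lra.
have sin0 : 0 <= sin eta by apply: sin_ge0_pi; lra.
have sin1 : sin eta <= eta := sin_le_id (ltW eta0).
have cs : cos eta ^+ 2 = 1 - sin eta ^+ 2 by rewrite -(cos2Dsin2 eta); ring.
have cos2 : 2^-1 <= cos eta.
  rewrite leNgt; apply/negP => c2.
  have cc : 0 < (2^-1 - cos eta) * (2^-1 + cos eta) by apply: mulr_gt0; lra.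
  have ss : 0 <= (6^-1 - sin eta) * (6^-1 + sin eta) by apply: mulr_ge0; lra.
  lra.
have key : al * L * cos eta <= (1 + be * L) * sin eta.
  have h1 := ler_wpM2l sin0 (cosh_le_sinh (ltW x0)).
  rewrite -(ler_pM2r sh0).
  have -> : al * L * cos eta * sinh (be * L) = sin eta * (be * L * cosh (be * L)).
    rewrite -[RHS](_ : L * (be * sin eta * cosh (be * L)) = _); last by ring.
    by rewrite -disp'; ring.
  by apply: le_trans h1 _; rewrite mulrA [sin eta * _]mulrC.
have key2 : (1 + be * L) * sin eta <= al * (1 + L) * eta.
  apply: ler_pM => //; first by lra.
  have : be * L <= al * L by rewrite ler_wpM2r// ltW.
  lra.
have key3 : al * L * 2^-1 <= al * (1 + L) * eta.
  apply: le_trans key2; apply: le_trans key.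
  by rewrite ler_wpM2l// mulr_ge0// ltW.
have key4 : L * 2^-1 <= (1 + L) * eta by rewrite -(ler_pM2l al0) !mulrA.
have : eta * 2 < L / (3 * (1 + L)) by rewrite etaE; lra.
rewrite ltr_pdivlMr; last by lra.
have : 0 < (1 + L) * eta by rewrite mulr_gt0.
lra.
Qed.

End DispersionRoots.

(** * The largest guided eigenvalue *)

Section LastGuided.
Context {R : realType}.
Implicit Types (S G : set R) (lam : R).

(** The parts of [S] below the various thresholds are nested, so the only one with
    [n] elements is [G] itself. *)
Lemma get_top_below S (b : R) (G := S `&` [set x | x < b]) (n : nat)
    (lam := [get x | S x /\ (S `&` [set y | (y <= x)%R] #= `I_n)%card]) :
  (G #= `I_n)%card -> G !=set0 -> G lam /\ forall mu, G mu -> mu <= lam.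
Proof.
move=> cG G0; have finG : finite_set G by exists n.
have [M GM Mmax] : exists2 M, G M & forall x, G x -> x <= M.
  have [||M] := @compact_EVT_max _ R id G G0.
  - exact: finite_compact.
  - by apply: continuous_subspaceT => x; exact: cvg_id.
  by rewrite inE => GM Mmax; exists M => // x Gx; apply: Mmax; rewrite inE.
have [] : [set x | S x /\ (S `&` [set y | (y <= x)%R] #= `I_n)%card] lam.
  apply: getPex; exists M; split; first by case: GM.
  rewrite (_ : S `&` _ = G)//; apply/seteqP; split => x /=.
    by move=> [Sx xM]; split => //; apply: le_lt_trans xM _; case: GM.
  by move=> Gx; split; [case: Gx|exact: Mmax].
move=> Slam; set T := S `&` _ => cT.
have finT : finite_set T by exists n.
have chain (A B : set R) : finite_set A -> finite_set B -> (A #= `I_n)%card ->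
    (B #= `I_n)%card -> A `<=` B -> A = B.
  move=> fA fB cA cB AB; apply: fset_set_inj => //; apply/eqP.
  have AB' : (fset_set A `<=` fset_set B)%fset by rewrite -fset_set_sub.
  by rewrite eqEfcard AB' (card_fset_set cA) (card_fset_set cB) leqnn andbT.
have Tlam : T lam by split => /=.
have [lamb|blam] := ltP lam b.
  have TG : T = G.
    by apply: chain => // x [Sx xlam]; split => //=; exact: le_lt_trans xlam lamb.
  by rewrite -TG; split => // mu [].
have GT : G = T.
  apply: chain => // x [Sx xb]; split => //=.
  exact: le_trans (ltW xb) blam.
by move: Tlam; rewrite -GT => -[_] /=; rewrite ltNge blam.
Qed.

(** If the guided set were infinite, its cardinal as a finite set would be [0]; no
    eigenvalue has index [0], so the default value [0] would be selected, which is
    below every eigenvalue. *)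
Lemma last_guided_eigenval_max (H c1 : R) k u (lamL := last_guided_eigenval H c1 k) :
  h0 < H -> 1 < c1 -> mode_function H c1 k lamL u ->
  guided H c1 k lamL /\ forall mu, guided H c1 k mu -> mu <= lamL.
Proof.
move=> hH c11 mu; set ka := k%:R ^+ 2 * pi ^+ 2 : R.
pose S := mode_spectrum H c1 k.
have gE : guided H c1 k = S `&` [set x | x < c1 * ka].
  apply/seteqP; split => x /= [Sx].
    by move=> /andP[_ xc]; split.
  move=> xc; split => //; have [w wx] := Sx.
  by apply/andP; split => //; exact: mode_eigenvalue_gt hH c11 wx.
have [n0|n0] := eqVneq (nb_guided H c1 k) 0%N.
  have lam0 : lamL = 0.
    rewrite /lamL /last_guided_eigenval n0 /eigenval getPN// => x [Sx].
    rewrite II0 card_eq0 => /eqP E.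
    have : (mode_spectrum H c1 k `&` [set y | (y <= x)%R]) x by split => /=.
    by rewrite E.
  have := mode_eigenvalue_gt hH c11 mu; rewrite lam0 ltNge.
  by rewrite mulr_ge0// sqr_ge0.
have finG : finite_set (guided H c1 k).
  by apply: contrapT => inf; move: n0; rewrite /nb_guided /fset_set; case: pselect.
have G0 : guided H c1 k !=set0.
  apply/set0P; apply: contraNneq n0; rewrite /nb_guided => ->.
  by rewrite fset_set0.
have [n cG] := finG; rewrite /lamL /last_guided_eigenval /eigenval /nb_guided.
rewrite (card_fset_set cG); rewrite gE in cG G0 *.
exact: get_top_below.
Qed.

End LastGuided.

(** * Decay rate of the last guided mode *)

Section DecayRate.
Context {R : realType}.
Implicit Types (al be lam rho H : R) (k n : nat).

Lemma powR_quarter lam : 0 <= lam -> 0 <= lam `^ 4^-1 /\ (lam `^ 4^-1) ^+ 4 = lam.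
Proof.
move=> lam0; split; first exact: powR_ge0.
by rewrite -powR_mulrn ?powR_ge0// -powRrM mulVf// powRr1.
Qed.

Lemma guided_exists H (c1 : R) k m (amax := Num.sqrt (c1 - 1) * (k%:R * pi))
    (ka := k%:R ^+ 2 * pi ^+ 2) :
  h0 < H -> 1 < c1 -> (1 <= m)%N -> 2 * (m%:R * pi) <= amax ->
  exists al be, [/\ 0 < al < amax, 0 < be, 2 * (m%:R * pi) - pi <= al,
     dispersion (H - h0) al be = 0 & guided H c1 k (ka + al ^+ 2)].
Proof.
move=> hH c11 m1 mamax; have c10 : 0 < c1 by lra.
have L0 : 0 < H - h0 by rewrite subr_gt0.
have [al [be [alP be0 mal be2 disp]]] := dispersion_root_exists m1 L0 c10 mamax.
have amax2 : amax ^+ 2 = (c1 - 1) * ka.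
  by rewrite /amax /ka exprMn sqr_sqrtr; [ring|lra].
exists al, be; split => //; have /andP[al0 ala] := alP; split.
  apply: (dispersion_mode hH al0 be0 _ _ disp); first by rewrite -/ka; ring.
  rewrite -/ka; apply: (mulfI (x := c1)); first by rewrite gt_eqF.
  rewrite be2 amax2; field; by rewrite gt_eqF.
rewrite /= -/ka ltrDl exprn_gt0//=.
have : al ^+ 2 < amax ^+ 2 by rewrite ltr_pXn2r// nnegrE; lra.
rewrite amax2; lra.
Qed.

(** If [2 m pi] is the largest multiple of [2 pi] below [amax], there is a root above
    [2 m pi - pi], so that [amax - al <= 4 pi] for the largest root. Then
    [c1 be^2 = (amax - al) (amax + al)] is at most [8 pi amax], and
    [amax = sqrt (c1 - 1) k pi] is at most [sqrt (c1 - 1) lam^(1/2)]. *)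
Lemma last_guided_rate_le H (c1 : R) : h0 < H -> 1 < c1 ->
  exists2 M : R, 0 < M & forall k u al be (ka := k%:R ^+ 2 * pi ^+ 2)
    (lam := last_guided_eigenval H c1 k), mode_function H c1 k lam u ->
    0 < al -> 0 < be -> al ^+ 2 = lam - ka -> be ^+ 2 = ka - lam / c1 ->
    be <= M * lam `^ 4^-1.
Proof.
move=> hH c11; have c10 : 0 < c1 by lra.
pose s := Num.sqrt (c1 - 1).
have s0 : 0 < s by rewrite sqrtr_gt0; lra.
have s2 : s ^+ 2 = c1 - 1 by rewrite sqr_sqrtr; lra.
have pi0 := pi_gt0 R.
exists (8 * pi * s + 1); first by rewrite ltr_wpDl// !mulr_ge0// ltW.
move=> k u al be ka lam mode al0 be0 al2 be2.
have [gl lmax] := last_guided_eigenval_max hH c11 mode.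
pose kap : R := k%:R * pi.
have kap2 : kap ^+ 2 = ka by rewrite /kap /ka exprMn.
have kap0 : 0 <= kap by rewrite mulr_ge0// ltW.
pose amax := s * kap.
have amax0 : 0 <= amax by rewrite mulr_ge0// ltW.
have cbe : c1 * be ^+ 2 = amax ^+ 2 - al ^+ 2.
  rewrite be2 al2 /amax exprMn s2 kap2; field; by rewrite gt_eqF.
have alamax : al < amax.
  have : 0 < amax ^+ 2 - al ^+ 2 by rewrite -cbe mulr_gt0// exprn_gt0.
  by rewrite subr_gt0 ltr_pXn2r// nnegrE// ltW.
have gap : amax - al <= 4 * pi.
  have [small|big] := ltP amax (2 * pi); first by lra.
  have q1 : 1 <= amax / (2 * pi) by rewrite ler_pdivlMr; lra.
  have q0 : 0 <= amax / (2 * pi) by lra.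
  pose m := Num.truncn (amax / (2 * pi)).
  have /andP[] := truncn_itv q0; rewrite -/m => ml mr.
  have m1 : (1 <= m)%N by rewrite -ltnS -(ltr_nat R); exact: le_lt_trans q1 mr.
  have ml' : 2 * (m%:R * pi) <= amax.
    by move: ml; rewrite ler_pdivlMr; lra.
  have mr' : amax < 2 * (m%:R * pi) + 2 * pi.
    by move: mr; rewrite ltr_pdivrMr -?natr1; lra.
  have [al' [be' [al'P _ mal _ g']]] := guided_exists hH c11 m1 ml'.
  have := lmax _ g'; rewrite -/lam -/ka => le2.
  have : al' <= al.
    rewrite -(@ler_pXn2r _ 2)// ?nnegrE ?(ltW al0)//; last by lra.
    by rewrite al2; lra.
  lra.
have lam0 : 0 <= lam by have := sqr_ge0 al; have := sqr_ge0 kap; lra.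
have [y0 y4] := powR_quarter lam0; set y := _ `^ _ in y0 y4 *.
have kapy : kap <= y ^+ 2.
  rewrite -(@ler_pXn2r _ 2)// ?nnegrE ?sqr_ge0// -exprM y4 kap2.
  by have := sqr_ge0 al; lra.
have be_le : be ^+ 2 <= 8 * pi * s * y ^+ 2.
  have b1 : be ^+ 2 <= c1 * be ^+ 2 by rewrite ler_peMl ?sqr_ge0// ltW.
  apply: (le_trans b1); rewrite cbe subr_sqr.
  apply: (@le_trans _ _ (4 * pi * (2 * amax))).
    by apply: ler_pM; lra.
  rewrite (_ : 4 * pi * (2 * amax) = 8 * pi * s * kap); last by rewrite /amax; ring.
  by apply: ler_wpM2l => //; rewrite !mulr_ge0// ltW.
have t0 : 0 <= 8 * pi * s by rewrite !mulr_ge0// ltW.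
rewrite -(@ler_pXn2r _ 2)// ?nnegrE ?(ltW be0)//; last by rewrite mulr_ge0// addr_ge0.
apply: (le_trans be_le); rewrite exprMn ler_wpM2r ?sqr_ge0//.
by have := sqr_ge0 (8 * pi * s); lra.
Qed.

(** In terms of the cut-off, [amax = 2 (n + rho) pi]: it lies in the first half of a
    period [2 pi] of [tan (al / 2)]. *)
Definition lower_half_period (c1 : R) k : Prop :=
  exists n rho, Num.sqrt (c1 - 1) * k%:R = 2 * (n%:R + rho) /\ 0 <= rho <= 2^-1.

(** [c1 be^2 = (amax - al) (amax + al)] is at least [amax] times the constant of
    [dispersion_root_gap], and [lam^(1/2)] is at most [c1 k pi]. *)
Lemma guided_rate_ge H (c1 : R) : h0 < H -> 1 < c1 ->
  exists2 m : R, 0 < m & forall k al be lam (ka := k%:R ^+ 2 * pi ^+ 2),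
    lower_half_period c1 k -> 0 < al -> 0 < be ->
    al ^+ 2 = lam - ka -> be ^+ 2 = ka - lam / c1 ->
    dispersion (H - h0) al be = 0 -> m * lam `^ 4^-1 <= be.
Proof.
move=> hH c11; have c10 : 0 < c1 by lra.
pose s := Num.sqrt (c1 - 1); pose L := H - h0.
have L0 : 0 < L by rewrite subr_gt0.
have s0 : 0 < s by rewrite sqrtr_gt0; lra.
have s2 : s ^+ 2 = c1 - 1 by rewrite sqr_sqrtr; lra.
have pi0 := pi_gt0 R.
pose del := L / (3 * (1 + L)).
have del0 : 0 < del by rewrite divr_gt0// mulr_gt0//; lra.
have d0 : 0 < del * s / c1 ^+ 2 by apply: divr_gt0; [exact: mulr_gt0|exact: exprn_gt0].
exists (Num.sqrt (del * s / c1 ^+ 2)); first by rewrite sqrtr_gt0.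
move=> k al be lam ka [n [rho [snrho rhoP]]] al0 be0 al2 be2 disp.
pose kap : R := k%:R * pi.
have kap2 : kap ^+ 2 = ka by rewrite /kap /ka exprMn.
have kap0 : 0 <= kap by rewrite mulr_ge0// ltW.
pose amax := s * kap.
have amaxE : amax = 2 * ((n%:R + rho) * pi).
  by rewrite /amax /kap [RHS]mulrA -snrho -mulrA.
have cbe : c1 * be ^+ 2 = amax ^+ 2 - al ^+ 2.
  rewrite be2 al2 /amax exprMn s2 kap2; field; by rewrite gt_eqF.
have gap : del <= amax - al := dispersion_root_gap L0 c11 al0 be0 amaxE rhoP cbe disp.
have lam0 : 0 <= lam by have := sqr_ge0 al; have := sqr_ge0 kap; lra.
have [y0 y4] := powR_quarter lam0; set y := _ `^ _ in y0 y4 *.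
have y2 : y ^+ 2 <= c1 * kap.
  rewrite -(@ler_pXn2r _ 2)// ?nnegrE ?sqr_ge0//; last by rewrite mulr_ge0// ltW.
  rewrite -exprM y4 exprMn kap2.
  have lamc : lam <= c1 * ka.
    have : lam / c1 <= ka by have := sqr_ge0 be; lra.
    by rewrite ler_pdivrMr// mulrC.
  apply: (le_trans lamc); rewrite ler_wpM2r//; first by rewrite -kap2 sqr_ge0.
  by rewrite expr2 ler_peMl// ltW.
have be_ge : del * s / c1 ^+ 2 * y ^+ 2 <= be ^+ 2.
  rewrite mulrAC ler_pdivrMr ?exprn_gt0//.
  rewrite (_ : be ^+ 2 * c1 ^+ 2 = c1 * (c1 * be ^+ 2)); last by ring.
  apply: (@le_trans _ _ (del * s * (c1 * kap))).
    by rewrite ler_wpM2l// mulr_ge0// ltW.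
  rewrite (_ : del * s * (c1 * kap) = c1 * (del * amax)); last by rewrite /amax; ring.
  rewrite ler_wpM2l ?(ltW c10)// cbe subr_sqr.
  apply: ler_pM => //; [exact: ltW|by lra|by lra].
rewrite -(@ler_pXn2r _ 2)// ?nnegrE ?(ltW be0)//; last by rewrite mulr_ge0// sqrtr_ge0.
by rewrite exprMn sqr_sqrtr ?(ltW d0).
Qed.

(** The distance of [sk/2] to the next integer doubles with [k] as long as it
    stays below [1/2]; hence some multiple [2^j k] leaves the upper half. *)
Lemma lower_half_period_doubling (c1 : R) k : 1 < c1 -> (1 <= k)%N ->
  exists j, lower_half_period c1 (2 ^ j * k).
Proof.
move=> c11 k1; apply: contrapT => none.
pose s := Num.sqrt (c1 - 1).
have s0 : 0 < s by rewrite sqrtr_gt0; lra.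
have [n0 [x0 [E0 /andP[x0_gt0 x0_lt] n01]]] : exists n x,
    [/\ s * k%:R = 2 * (n%:R - x), 0 < x < 2^-1 & (1 <= n)%N].
  pose t := s * k%:R / 2.
  have t0 : 0 <= t by rewrite divr_ge0// mulr_ge0// ltW.
  have /andP[tl tr] := truncn_itv t0.
  exists (Num.truncn t).+1, ((Num.truncn t).+1%:R - t); split => //.
    by rewrite opprB addrC subrK /t; field.
  rewrite subr_gt0 tr/= ltNge; apply/negP => x2; apply: none; exists 0%N.
  exists (Num.truncn t), (t - (Num.truncn t)%:R); split.
    by rewrite [X in 2 * X]addrC subrK mul1n /t -/s; field.
  by move: x2; rewrite -(natr1 (Num.truncn t)); lra.
have dbl j : exists n : nat, [/\ s * (2 ^ j * k)%:R = 2 * (n%:R - 2 ^+ j * x0),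
    2 ^+ j * x0 < 2^-1 & (1 <= n)%N].
  elim: j => [|j [n [E xj n1]]]; first by exists n0; rewrite expr0 mul1r mul1n.
  have E' : s * (2 ^ j.+1 * k)%:R = 2 * (2 * n%:R - 2 ^+ j.+1 * x0).
    by rewrite expnS -mulnA natrM mulrCA E exprS; ring.
  have [lt12|ge12] := ltP (2 ^+ j.+1 * x0) 2^-1.
    exists (2 * n)%N; split => //; first by rewrite E' natrM.
    by rewrite muln_gt0.
  exfalso; apply: none; exists j.+1, (2 * n - 1)%N, (1 - 2 ^+ j.+1 * x0); split.
    rewrite -/s E' natrB ?natrM; first by ring.
    by rewrite muln_gt0.
  move: xj ge12; rewrite exprS -mulrA; move: (2 ^+ j * x0) => p; lra.
have [j jP] : exists j : nat, x0^-1 < j%:R.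
  have i0 : 0 <= x0^-1 by rewrite invr_ge0 ltW.
  by exists (Num.truncn x0^-1).+1; have /andP[] := truncn_itv i0.
have [_ [_ + _]] := dbl j; apply/negP; rewrite -leNgt.
have : j%:R <= 2 ^+ j :> R by rewrite -natrX ler_nat ltnW// ltn_expl.
have : 1 < j%:R * x0 by rewrite -ltr_pdivrMr// div1r.
move=> h1 h2; have : j%:R * x0 <= 2 ^+ j * x0 by rewrite ler_wpM2r// ltW.
lra.
Qed.

(** Were there only finitely many such [k], doubling from a number beyond all of them
    and beyond [2 / sqrt (c1 - 1)], where guided modes exist, would yield another. *)
Lemma infinite_lower_half_period H (c1 : R) : h0 < H -> 1 < c1 ->
  infinite_set [set k | has_guided H c1 k /\ lower_half_period c1 k].
Proof.
move=> hH c11 /finite_seqP[ks ksE].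
pose s := Num.sqrt (c1 - 1).
have s0 : 0 < s by rewrite sqrtr_gt0; lra.
pose N := (Num.truncn (2 / s)).+1.
have sN : 2 < s * N%:R.
  have q0 : 0 <= 2 / s by rewrite divr_ge0// ltW.
  have /andP[_] := truncn_itv q0; rewrite ltr_pdivrMr// mulrC.
  by rewrite mulrC.
pose k0 := (\max_(k <- ks) k + N)%N.
have k01 : (1 <= k0)%N by rewrite /k0 /N addnS.
have [j lower] := lower_half_period_doubling c11 k01.
have kj : (k0 <= 2 ^ j * k0)%N by rewrite leq_pmull// expn_gt0.
have : [set k | has_guided H c1 k /\ lower_half_period c1 k] (2 ^ j * k0)%N.
  split=> //; split; first exact: leq_trans k01 kj.
  have big : 2 * (1%:R * pi) <= s * ((2 ^ j * k0)%:R * pi).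
    rewrite mul1r mulrA ler_wpM2r ?pi_ge0//.
    apply: (le_trans (ltW sN)); rewrite ler_wpM2l ?(ltW s0)// ler_nat.
    by apply: leq_trans kj; rewrite /k0 leq_addl.
  have [al [be [_ _ _ _ g]]] := guided_exists hH c11 (leqnn 1) big.
  by exists (((2 ^ j * k0)%:R) ^+ 2 * pi ^+ 2 + al ^+ 2).
rewrite ksE /= => kin.
have := @leq_bigmax_seq _ ks xpredT id _ kin isT; rewrite leqNgt => /negP; apply.
by apply: leq_trans kj; rewrite /k0 /N addnS ltnS leq_addr.
Qed.

End DecayRate.

(** * Norms of product functions *)

Section Norms.
Context {R : realType}.
Implicit Types (f g u : R -> R) (x p q H : R).
Local Notation leb := (@lebesgue_measure R).

Definition sqint (D : set R) u : \bar R := (\int[leb]_(x in D) (u x ^+ 2)%:E)%E.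

Lemma measurable_sqr D u : measurable_fun D u ->
  measurable_fun D (fun x : R => (u x ^+ 2)%:E).
Proof. by move=> mu; apply/measurable_EFinP; exact: measurable_funX. Qed.

Lemma sqint_ge0 D u : (0 <= sqint D u)%E.
Proof. by apply: integral_ge0 => x _; rewrite lee_fin sqr_ge0. Qed.

Lemma sqint_subset (A B : set R) u : measurable A -> measurable B ->
  measurable_fun B u -> A `<=` B -> (sqint A u <= sqint B u)%E.
Proof.
move=> mA mB mu AB; apply: ge0_subset_integral => //; first exact: measurable_sqr.
by move=> x _; rewrite lee_fin sqr_ge0.
Qed.

Lemma sqint_itv_ge p q u (m : R) : p < q -> measurable_fun `]p, q[ u -> 0 <= m ->
  (forall x, p < x < q -> m <= u x ^+ 2) ->
  ((m * (q - p))%:E <= sqint `]p, q[ u)%E.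
Proof.
move=> pq mu m0 mle.
have <- : (\int[leb]_(x in `]p, q[) (m%:E) = (m * (q - p))%:E)%E.
  by rewrite integral_cst//= lebesgue_measure_itv/= lte_fin pq -EFinB -EFinM.
apply: ge0_le_integral => //; exact: measurable_sqr.
Qed.

Lemma sqint_itv_le p q u (m : R) : p < q -> measurable_fun `]p, q[ u ->
  (forall x, p < x < q -> u x ^+ 2 <= m) ->
  (sqint `]p, q[ u <= (m * (q - p))%:E)%E.
Proof.
move=> pq mu mle.
have <- : (\int[leb]_(x in `]p, q[) (m%:E) = (m * (q - p))%:E)%E.
  by rewrite integral_cst//= lebesgue_measure_itv/= lte_fin pq -EFinB -EFinM.
apply: ge0_le_integral => //.
- by move=> x _; rewrite lee_fin sqr_ge0.
- exact: measurable_sqr.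
Qed.

Lemma sqintZ D u (c : R) : measurable D -> measurable_fun D u ->
  sqint D (fun x => c * u x) = ((c ^+ 2)%:E * sqint D u)%E.
Proof.
move=> mD mu; rewrite /sqint -ge0_integralZl_EFin ?sqr_ge0//.
- by apply: eq_integral => x _; rewrite exprMn EFinM.
- by move=> x _; rewrite lee_fin sqr_ge0.
- exact: measurable_sqr.
Qed.

(** Tonelli's theorem. *)
Lemma sqnormL2_prod (A B : set R) f g : measurable A -> measurable B ->
  measurable_fun A f -> measurable_fun B g ->
  sqnormL2 (A `*` B) (fun z => f z.1 * g z.2) = (sqint A f * sqint B g)%E.
Proof.
move=> mA mB mf mg.
have mfA : measurable_fun setT (f \_ A).
  by apply/measurable_restrict => //; rewrite setTI.
have mgB : measurable_fun setT (g \_ B).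
  by apply/measurable_restrict => //; rewrite setTI.
have sqE D h : sqint D h = (\int[leb]_x (((h \_ D) x) ^+ 2)%:E)%E.
  rewrite /sqint integral_mkcond; apply: eq_integral => x _.
  by rewrite /patch; case: ifP => // _; rewrite expr0n.
pose F (z : R * R) : \bar R := (((f \_ A) z.1 * (g \_ B) z.2) ^+ 2)%:E.
have -> : sqnormL2 (A `*` B) (fun z => f z.1 * g z.2) = (\int[leb \x leb]_z F z)%E.
  have -> : (\int[leb \x leb]_z F z = \int[leb \x leb]_z
      (`|(EFin \o ((fun z => f z.1 * g z.2)%R \_ (A `*` B))) z| `^ 2))%E.
    apply: eq_integral => -[x y] _ /=.
    rewrite (powR_mulrn 2 (normr_ge0 _)) real_normK ?num_real// /F /= /patch.
    rewrite in_setX/=; case: (x \in A) => /=; last by rewrite mul0r.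
    by case: (y \in B) => //=; rewrite mulr0.
  rewrite -poweR_Lnorm// /sqnormL2; move: (Lnorm_ge0 (leb \x leb)%E 2%:E
    (EFin \o ((fun z => f z.1 * g z.2) \_ (A `*` B)))).
  case: Lnorm => [r r0| |//]; last by rewrite poweRyr// expe2 mulyy.
  by rewrite poweR_EFin (powR_mulrn 2) ?EFin_expe.
rewrite fubini_tonelli1//; last 2 first.
- apply/measurable_EFinP; apply: measurable_funX; apply: measurable_funM.
    exact: measurableT_comp mfA measurable_fst.
  exact: measurableT_comp mgB measurable_snd.
- by move=> x; rewrite lee_fin sqr_ge0.
rewrite /fubini_F.
under eq_integral => x _.
  under eq_integral => y _ do rewrite /F exprMn EFinM -[(x, y).1]/x -[(x, y).2]/y.
  rewrite ge0_integralZl_EFin ?sqr_ge0//; last 2 first.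
  - by move=> y _; rewrite lee_fin sqr_ge0.
  - exact: measurable_sqr.
  rewrite -sqE muleC.
  over.
rewrite ge0_integralZl//; last 3 first.
- exact: measurable_sqr.
- by move=> x _; rewrite lee_fin sqr_ge0.
- exact: sqint_ge0.
by rewrite -sqE muleC.
Qed.

End Norms.

(** * Mass of a mode in a strip *)

Section Mass.
Context {R : realType}.
Implicit Types (f g u : R -> R) (x p q H al be A B a b t : R).
Local Notation leb := (@lebesgue_measure R).

Lemma sin_sqr_le1 x : sin x ^+ 2 <= 1.
Proof. by have := cos2Dsin2 x; have := sqr_ge0 (cos x); lra. Qed.

Lemma abs_sin_le_double t : 0 <= t -> `|sin t| <= t * `|cos (t / 2)|.
Proof.
move=> t0; have -> : sin t = 2 * (sin (t / 2) * cos (t / 2)).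
  by rewrite [in LHS](splitr t) sinD; ring.
rewrite normrM normrM mulrA ler_wpM2r// gtr0_norm// -ler_pdivlMl//.
have t2 : 0 <= t / 2 by lra.
rewrite ler_norml mulrC sin_le_id//andbT lerNl -sinN.
have [tpi|pit] := leP (t / 2) pi.
  by rewrite (le_trans _ t2)// sinN oppr_le0 sin_ge0_pi// t2.
have := pi_ge2 R; have := sin_le1 (- (t / 2)); lra.
Qed.

(** For [t >= 2] because [|sin t| <= 1]; for [t0 <= t <= 2] because
    [|sin t| <= t cos (t / 2)] and the cosine is decreasing. *)
Lemma abs_sin_le_contraction (t0 : R) : 0 < t0 ->
  exists2 r : R, r < 1 & forall t, t0 <= t -> `|sin t| <= r * t.
Proof.
move=> t00; have pi2 := pi_ge2 R.
pose t1 := Num.min t0 2.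
have t1P : 0 < t1 <= 2 by rewrite /t1 lt_min ge_min t00 lexx orbT; lra.
have t1t0 : t1 <= t0 by rewrite /t1 ge_min lexx.
have c1 : cos (t1 / 2) < 1.
  by rewrite -[ltRHS](@cos0 R) ltr_cos ?in_itv/=; lra.
have c0 : 0 <= cos (t1 / 2) by apply: cos_ge0_pihalf; lra.
exists (Num.max 2^-1 (cos (t1 / 2))); first by rewrite gt_max c1 andbT; lra.
move=> t t0t; have [t2|t2] := leP 2 t.
  apply: (@le_trans _ _ (2^-1 * t)).
    by apply: (@le_trans _ _ 1); [rewrite ler_norml sin_le1 sin_geN1|lra].
  by rewrite ler_wpM2r ?le_max ?lexx//; lra.
apply: (le_trans (abs_sin_le_double _)); first by lra.
rewrite mulrC ler_wpM2r//; first by lra.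
have ct : 0 <= cos (t / 2) by apply: cos_ge0_pihalf; lra.
rewrite ger0_norm// le_max; apply/orP; right.
have [e|ne] := eqVneq (t1 / 2) (t / 2); first by rewrite e.
by rewrite ltW// ltr_cos ?in_itv/=; lra.
Qed.

Lemma sqint_itv_sin p q (m : R) : p < q -> 0 < m ->
  sqint `]p, q[ (fun x => sin (m * x)) =
  (((q - p) / 2 - (sin (2 * m * q) - sin (2 * m * p)) / (4 * m)))%:E.
Proof.
move=> pq m0; pose f x := sin (m * x) ^+ 2.
have cs : continuous (fun x => sin (m * x)).
  by apply: (@derivable_continuous _ _ (fun x => cos (m * x) * m)) => x; der; ring.
have cf : continuous f by move=> x; apply: (cvgM (cs x) (cs x)).
pose F x := x / 2 - sin (2 * m * x) / (4 * m).
have Fd x : is_derive x 1 F (f x).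
  have E : 2 * m * x = m * x + m * x by ring.
  rewrite /F; der; rewrite E cosD /f; have := cos2Dsin2 (m * x).
  move: (sin _) (cos _) => s c sc; rewrite -expr2 -expr2.
  have -> : c ^+ 2 = 1 - s ^+ 2 by rewrite -sc; ring.
  by field; rewrite gt_eqF.
have cF := derivable_continuous Fd.
have Fd' x : p < x < q -> is_derive x 1 F (f x) by move=> _; exact: Fd.
have := Rintegral_derive pq cf cF Fd'; rewrite -Rintegral_oo_cc// => E.
rewrite /sqint -[LHS]fineK.
  congr EFin; rewrite -[LHS]/(\int[leb]_(x in `]p, q[) f x) E /F; field.
  by rewrite gt_eqF.
apply: integrable_fin_num => //.
apply: integrableS (continuous_integrable p q cf) => // x /=.
by rewrite !in_itv/= => /andP[/ltW -> /ltW ->].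
Qed.

(** On an interval [(p, q)] with [e = q - p], the integral of [sin^2 (m x)] is
    [(m e - cos (m (p + q)) sin (m e)) / (2 m)]. As [m e >= pi e],
    [abs_sin_le_contraction] bounds it below by a fixed multiple of [e]. *)
Lemma sqint_sin_uniform (omega1 : set R) : open omega1 -> omega1 !=set0 ->
  exists2 c : R, 0 < c & forall k, (1 <= k)%N ->
    (c%:E <= sqint omega1 (fun x => sin (k%:R * pi * x)))%E.
Proof.
move=> oom [x0 x0om]; have pi0 := pi_gt0 R.
have /nbhs_ballP[e /= e0 eom] : nbhs x0 omega1 by exact: open_nbhs_nbhs.
pose p := x0 - e / 2; pose q := x0 + e / 2.
have pq : p < q by rewrite /p /q; lra.
have sub : `]p, q[%classic `<=` omega1.
  move=> x /=; rewrite in_itv/= => /andP[px xq]; apply: eom.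
  by rewrite /ball/= ltr_norml; move: px xq; rewrite /p /q; lra.
have [r r1 rP] := abs_sin_le_contraction (mulr_gt0 pi0 e0).
exists ((1 - r) * e / 2); first by rewrite divr_gt0// mulr_gt0// subr_gt0.
move=> k k1; pose m : R := k%:R * pi.
have k1' : 1 <= k%:R :> R by rewrite ler1n.
have m0 : 0 < m by rewrite mulr_gt0//; lra.
have cs : continuous (fun x => sin (m * x)).
  by apply: (@derivable_continuous _ _ (fun x => cos (m * x) * m)) => x; der; ring.
apply: (@le_trans _ _ (sqint `]p, q[ (fun x => sin (m * x)))); last first.
  apply: sqint_subset => //; first exact: open_measurable.
  by apply: measurable_funTS; exact: continuous_measurable_fun.
rewrite sqint_itv_sin// lee_fin.
have qp : q - p = e by rewrite /p /q; field.
have ds : sin (2 * m * q) - sin (2 * m * p) = 2 * (cos (m * (p + q)) * sin (m * e)).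
  rewrite -qp (_ : 2 * m * q = m * (p + q) + m * (q - p)); last by ring.
  rewrite (_ : 2 * m * p = m * (p + q) - m * (q - p)); last by ring.
  by rewrite sinD sinB; ring.
have sle : `|sin (m * e)| <= r * (m * e).
  by apply: rP; rewrite ler_wpM2r ?(ltW e0)// /m ler_peMl// ltW.
have cle : cos (m * (p + q)) * sin (m * e) <= r * (m * e).
  apply: le_trans (ler_norm _) _; rewrite normrM; apply: le_trans sle.
  by rewrite ler_piMl// ler_norml cos_le1 cos_geN1.
rewrite ds qp -subr_ge0.
rewrite (_ : _ - _ = (r * (m * e) - cos (m * (p + q)) * sin (m * e)) / (2 * m)).
  by rewrite divr_ge0 ?subr_ge0// mulr_ge0// ltW.
by field; rewrite gt_eqF.
Qed.

Lemma sqint_sin_le1 (omega1 : set R) k : measurable omega1 -> omega1 `<=` `]0, 1[ ->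
  (sqint omega1 (fun x => sin (k%:R * pi * x)) <= 1)%E.
Proof.
move=> mom sub.
have cs : continuous (fun x : R => sin (k%:R * pi * x)).
  apply: (@derivable_continuous _ _ (fun x => cos (k%:R * pi * x) * (k%:R * pi))) => x.
  by der; ring.
have ms D : measurable_fun D (fun x : R => sin (k%:R * pi * x)).
  by apply: measurable_funTS; exact: continuous_measurable_fun.
apply: (@le_trans _ _ (sqint `]0, 1[ (fun x => sin (k%:R * pi * x)))).
  exact: sqint_subset.
apply: le_trans (@sqint_itv_le _ 0 1 _ 1 ltr01 (ms _) _) _; last by rewrite subr0 mul1r.
by move=> x _; exact: sin_sqr_le1.
Qed.

(** In the cladding the profile is [B sinh (be (H - x))], at least [B be (H - b)] on
    [(a, b)] in absolute value. On the other hand [A^2] bounds [u^2] everywhere, and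
    the matching conditions give [A^2 <= B^2 be^2 (L^2 + 1) exp (2 be L)]. *)
Lemma strip_mass_ge H a b (L := H - h0) : h0 < a -> a < b -> b < H ->
  exists2 c : R, 0 < c & forall u al be A B, measurable_fun `]0, H[ u ->
    1 <= al -> 0 < be ->
    (forall x, 0 <= x <= h0 -> u x = A * sin (al * x)) ->
    (forall x, h0 <= x <= H -> u x = B * sinh (be * (H - x))) ->
    A * sin (al * h0) = B * sinh (be * L) ->
    A * al * cos (al * h0) = - (B * be * cosh (be * L)) ->
    ((c * expR (- (2 * L) * be))%:E * sqint `]0%R, H[ u <= sqint `]a, b[ u)%E.
Proof.
move=> ha ab bH; have h00 := @h0_gt0 R.
have L0 : 0 < L by rewrite subr_gt0; lra.
have H0 : 0 < H by lra.
have L21 : 0 < L ^+ 2 + 1 by rewrite ltr_wpDl ?sqr_ge0.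
pose c := (b - a) * (H - b) ^+ 2 / (H * (L ^+ 2 + 1)).
have c0 : 0 < c.
  apply: divr_gt0; last exact: mulr_gt0.
  by apply: mulr_gt0; [lra|apply: exprn_gt0; lra].
exists c => // u al be A B mu al1 be0 ul ur match1 match2.
have x0 : 0 <= be * L by rewrite mulr_ge0// ltW.
have ch0 := cosh_gt0 (be * L).
have A2 : A ^+ 2 <= B ^+ 2 * be ^+ 2 * (L ^+ 2 + 1) * expR (be * L) ^+ 2.
  have cs := cos2Dsin2 (al * h0).
  have -> : A ^+ 2 = (A * sin (al * h0)) ^+ 2 + (A * cos (al * h0)) ^+ 2.
    by rewrite !exprMn -mulrDr addrC cs mulr1.
  have e1 : (A * sin (al * h0)) ^+ 2 <= B ^+ 2 * be ^+ 2 * L ^+ 2 * cosh (be * L) ^+ 2.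
    rewrite match1 [leRHS](_ : _ = B ^+ 2 * (be * L * cosh (be * L)) ^+ 2); last by ring.
    rewrite [leLHS]exprMn ler_wpM2l ?sqr_ge0// ler_pXn2r// ?nnegrE ?sinh_ge0//.
      exact: sinh_le_cosh.
    by rewrite mulr_ge0// ltW.
  have e2 : (A * cos (al * h0)) ^+ 2 <= B ^+ 2 * be ^+ 2 * cosh (be * L) ^+ 2.
    have <- : (A * al * cos (al * h0)) ^+ 2 = B ^+ 2 * be ^+ 2 * cosh (be * L) ^+ 2.
      by rewrite match2 sqrrN !exprMn.
    rewrite [leRHS](_ : _ = al ^+ 2 * (A * cos (al * h0)) ^+ 2); last by ring.
    by rewrite ler_peMl ?sqr_ge0// exprn_ege1.
  have ec : cosh (be * L) ^+ 2 <= expR (be * L) ^+ 2.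
    by rewrite ler_pXn2r// ?nnegrE ?expR_ge0 ?(ltW ch0)// cosh_le_expR.
  have K0 : 0 <= B ^+ 2 * be ^+ 2 * (L ^+ 2 + 1).
    by apply: mulr_ge0; [apply: mulr_ge0; exact: sqr_ge0|exact: ltW].
  apply: le_trans (ler_wpM2l K0 ec).
  rewrite [leRHS](_ : _ = B ^+ 2 * be ^+ 2 * L ^+ 2 * cosh (be * L) ^+ 2 +
    B ^+ 2 * be ^+ 2 * cosh (be * L) ^+ 2); last by ring.
  exact: lerD.
have uA x : 0 < x < H -> u x ^+ 2 <= A ^+ 2.
  move=> xH; have [xh|/ltW hx] := leP x h0.
    rewrite ul; last by lra.
    by rewrite exprMn ler_piMr ?sqr_ge0// sin_sqr_le1.
  rewrite ur; last by lra.
  apply: (@le_trans _ _ ((A * sin (al * h0)) ^+ 2)).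
    rewrite match1 [leLHS]exprMn [leRHS]exprMn ler_wpM2l ?sqr_ge0//.
    have xx : 0 <= be * (H - x) by rewrite mulr_ge0//; lra.
    have xL : be * (H - x) <= be * L by rewrite ler_wpM2l// /L; lra.
    by rewrite ler_pXn2r// ?nnegrE ?sinh_ge0// sinh_ndecr.
  by rewrite exprMn ler_piMr ?sqr_ge0// sin_sqr_le1.
have up := sqint_itv_le H0 mu uA.
have mab : measurable_fun `]a, b[ u.
  apply: measurable_funS mu => // x /=; rewrite !in_itv/=; lra.
have lo : ((B ^+ 2 * be ^+ 2 * (H - b) ^+ 2 * (b - a))%:E <= sqint `]a, b[ u)%E.
  apply: sqint_itv_ge => //; first by rewrite -!exprMn sqr_ge0.
  move=> x xab; rewrite ur; last by lra.
  rewrite [leLHS](_ : _ = B ^+ 2 * (be * (H - b)) ^+ 2); last by ring.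
  rewrite [leRHS]exprMn ler_wpM2l ?sqr_ge0//.
  have Hb : 0 <= be * (H - b) by rewrite mulr_ge0//; lra.
  have Hx : be * (H - b) <= be * (H - x) by rewrite ler_wpM2l//; lra.
  have Hs := sinh_ge (le_trans Hb Hx).
  rewrite ler_pXn2r// ?nnegrE//; first exact: le_trans Hx Hs.
  exact: le_trans Hb (le_trans Hx Hs).
apply: le_trans lo.
have ce0 : (0 <= (c * expR (- (2 * L) * be))%:E)%E.
  by rewrite lee_fin mulr_ge0 ?expR_ge0// ltW.
apply: (le_trans (lee_wpmul2l ce0 up)).
rewrite -EFinM lee_fin subr0.
have eK : expR (- (2 * L) * be) * expR (be * L) ^+ 2 = 1.
  rewrite -expRM_natl -expRD -[RHS](@expR0 R); congr expR.
  by rewrite -[_ *+ 2]mulr_natl; ring.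
set E1 := expR (- (2 * L) * be) in eK *; set E2 := expR (be * L) in eK A2.
have cE0 : 0 <= c * E1 * H.
  apply: mulr_ge0; last exact: ltW.
  by apply: mulr_ge0; [exact: ltW|exact: expR_ge0].
rewrite (_ : c * E1 * (A ^+ 2 * H) = c * E1 * H * A ^+ 2); last by ring.
apply: (le_trans (ler_wpM2l cE0 A2)).
rewrite (_ : c * E1 * H * _ =
  c * (H * (L ^+ 2 + 1)) * (B ^+ 2 * be ^+ 2) * (E1 * E2 ^+ 2)); last by ring.
rewrite eK mulr1 /c divfK; last by rewrite gt_eqF// mulr_gt0.
by rewrite le_eqVlt; apply/orP; left; apply/eqP; ring.
Qed.

(** It is enough to compare [(a, b)] with the half of [(h0, a)] that is adjacent to the
    interface: the values there are larger by a factor at least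
    [exp (be (a - h0) / 2)]. *)
Lemma strip_mass_le H a b : h0 < a -> a < b -> b < H ->
  exists C D : R, [/\ 0 < C, 0 < D & forall u be B, measurable_fun `]0, H[ u ->
    0 < be -> (forall x, h0 <= x <= H -> u x = B * sinh (be * (H - x))) ->
    (sqint `]a, b[ u <= (C * expR (- D * be))%:E * sqint `]0%R, H[ u)%E].
Proof.
move=> ha ab bH; have h00 := @h0_gt0 R.
pose g := (a - h0) / 2; have g0 : 0 < g by rewrite /g; lra.
exists ((b - a) / g), (2 * g); split; [by rewrite divr_gt0//; lra|lra|].
move=> u be B mu be0 ur.
have mab : measurable_fun `]a, b[ u.
  by apply: measurable_funS mu => // x /=; rewrite !in_itv/=; lra.
pose m := (B * sinh (be * (H - a))) ^+ 2.
pose n := (B * sinh (be * (H - (h0 + g)))) ^+ 2.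
have up : (sqint `]a, b[ u <= (m * (b - a))%:E)%E.
  apply: sqint_itv_le => // x xab; rewrite ur; last by lra.
  rewrite /m [leLHS]exprMn [leRHS]exprMn ler_wpM2l ?sqr_ge0//.
  have xx : 0 <= be * (H - x) by rewrite mulr_ge0//; lra.
  have xa : be * (H - x) <= be * (H - a) by rewrite ler_wpM2l//; lra.
  by rewrite ler_pXn2r// ?nnegrE ?sinh_ge0// ?sinh_ndecr// (le_trans xx).
have hg : h0 < h0 + g by rewrite ltrDl.
have hga : h0 + g < a by rewrite /g; lra.
have subH : `]h0, (h0 + g)[%classic `<=` `]0, H[%classic.
  by move=> x /=; rewrite !in_itv/=; lra.
have mhg : measurable_fun `]h0, (h0 + g)[ u by exact: measurable_funS mu.
have lo : ((n * g)%:E <= sqint `]0%R, H[ u)%E.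
  apply: (@le_trans _ _ (sqint `]h0, (h0 + g)[ u)); last exact: sqint_subset.
  have {1}-> : g = (h0 + g) - h0 by rewrite addrAC subrr add0r.
  apply: sqint_itv_ge => //; first exact: sqr_ge0.
  move=> x xhg; rewrite ur; last by lra.
  rewrite /n [leLHS]exprMn [leRHS]exprMn ler_wpM2l ?sqr_ge0//.
  have xx : 0 <= be * (H - (h0 + g)) by rewrite mulr_ge0//; lra.
  have xa : be * (H - (h0 + g)) <= be * (H - x) by rewrite ler_wpM2l//; lra.
  by rewrite ler_pXn2r// ?nnegrE ?sinh_ge0// ?sinh_ndecr// (le_trans xx).
apply: (le_trans up).
have C0 : (0 <= ((b - a) / g * expR (- (2 * g) * be))%:E)%E.
  by rewrite lee_fin mulr_ge0 ?expR_ge0// divr_ge0//; lra.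
apply: le_trans (lee_wpmul2l C0 lo).
rewrite -EFinM lee_fin.
have ra : sinh (be * (H - a)) * expR (be * g) <= sinh (be * (H - (h0 + g))).
  have xx : 0 <= be * (H - a) by rewrite mulr_ge0//; lra.
  have yy : 0 <= be * g by rewrite mulr_ge0// ltW.
  by have := sinh_ratio xx yy; rewrite -mulrDr (_ : H - a + g = H - (h0 + g))// /g; field.
have sa : 0 <= sinh (be * (H - a)) by rewrite sinh_ge0// mulr_ge0//; lra.
have ra2 : m * expR (be * g) ^+ 2 <= n.
  rewrite /m /n [X in X * _]exprMn [leRHS]exprMn -mulrA ler_wpM2l ?sqr_ge0// -exprMn.
  by rewrite ler_pXn2r// ?nnegrE ?(le_trans _ ra)// mulr_ge0 ?expR_ge0.
have eK : expR (- (2 * g) * be) * expR (be * g) ^+ 2 = 1.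
  rewrite -expRM_natl -expRD -[RHS](@expR0 R); congr expR.
  by rewrite -[_ *+ 2]mulr_natl; ring.
set E1 := expR (- (2 * g) * be) in eK *; set E2 := expR (be * g) in eK ra2.
rewrite (_ : _ * (n * g) = (b - a) * (E1 * n)); last by field; rewrite gt_eqF.
rewrite mulrC ler_wpM2l//; first by lra.
have := ler_wpM2l (expR_ge0 (- (2 * g) * be)) ra2; rewrite -/E1.
by rewrite mulrCA eK mulr1.
Qed.

End Mass.

(** * Assembling the estimates *)

Section Assembly.
Context {R : realType}.
Implicit Types (u : R -> R) (H a b : R) (k : nat).

Lemma closure_strip (omega1 : set R) H a b (x : R) : omega1 x -> a < b ->
  closure (omega1 `*` `]a, b[) `<=` Omega1 H -> h0 < a /\ b < H.
Proof.
move=> omx ab sub; split.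
  have : closure (omega1 `*` `]a, b[) (x, a).
    move=> N nN; have : \forall y \near a^'+, N (x, y) /\ a < y < b.
      have [[P Q] /= [nP nQ] PQ] := nN.
      near=> y; split.
        apply: (PQ (x, y)); split => /=; first exact: nbhs_singleton nP.
        by near: y; apply: cvg_within; exact: nQ.
      apply/andP; split; first by near: y; exact: nbhs_right_gt.
      by near: y; exact: nbhs_right_lt.
    move=> /filter_ex[y [Ny yab]]; exists (x, y); split => //.
  by move=> cl; have [_ /=] := sub _ cl; rewrite in_itv/= => /andP[].
have : closure (omega1 `*` `]a, b[) (x, b).
  move=> N nN; have : \forall y \near b^'-, N (x, y) /\ a < y < b.
    have [[P Q] /= [nP nQ] PQ] := nN.
    near=> y; split.
      apply: (PQ (x, y)); split => /=; first exact: nbhs_singleton nP.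
      by near: y; apply: cvg_within; exact: nQ.
    apply/andP; split; first by near: y; exact: nbhs_left_gt.
    by near: y; exact: nbhs_left_lt.
  move=> /filter_ex[y [Ny yab]]; exists (x, y); split => //.
by move=> cl; have [_ /=] := sub _ cl; rewrite in_itv/= => /andP[].
Unshelve. all: by end_near. Qed.

Lemma mode_measurable H (c1 lam : R) k u : h0 < H -> mode_function H c1 k lam u ->
  measurable_fun `]0, H[ u.
Proof.
move=> hH /(mode_function_classical hH)[U [d [Uu sol _ _ _]]].
apply: (@eq_measurable_fun _ _ _ _ _ U); last first.
  apply: measurable_funTS; apply: continuous_measurable_fun.
  exact: layered_cont sol.
by move=> x; rewrite inE/= in_itv/= => /andP[x0 xH]; rewrite Uu// !ltW.
Qed.

Lemma sqnormL2_mode (A B : set R) k (alpha : R) u : measurable A -> measurable B ->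
  measurable_fun B u ->
  sqnormL2 (A `*` B) (fun x => alpha * Num.sqrt 2 * sin (k%:R * pi * x.1) * u x.2) =
  (((alpha * Num.sqrt 2) ^+ 2)%:E *
    (sqint A (fun x => sin (k%:R * pi * x)) * sqint B u))%E.
Proof.
move=> mA mB mu.
have cs : continuous (fun x : R => sin (k%:R * pi * x)).
  apply: (@derivable_continuous _ _ (fun x => cos (k%:R * pi * x) * (k%:R * pi))) => x.
  by der; ring.
have ms : measurable_fun A (fun x : R => sin (k%:R * pi * x)).
  by apply: measurable_funTS; exact: continuous_measurable_fun.
pose f x := alpha * Num.sqrt 2 * sin (k%:R * pi * x) : R.
rewrite (@sqnormL2_prod _ A B f u)//; last by apply: measurable_funM.
by rewrite /f sqintZ// muleA.
Qed.

(** The mass ratios of the two factors are bounded below by [sqint_sin_uniform] and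
    [strip_mass_ge], and [be] is at most a multiple of [lam^(1/4)]. *)
Lemma last_guided_lower_estimate H (c1 : R) a b (omega1 : set R) : h0 < H -> 1 < c1 ->
  open omega1 -> omega1 !=set0 -> omega1 `<=` `]0, 1[ ->
  h0 < a -> a < b -> b < H ->
  exists C D : R, [/\ 0 < C, 0 < D & forall k v, has_guided H c1 k ->
    last_guided_eigenfun H c1 k v ->
    lower_estimate H (omega1 `*` `]a, b[) C D (last_guided_eigenval H c1 k) v].
Proof.
move=> hH c11 oom om0 omsub ha ab bH; have h00 := @h0_gt0 R.
have [M M0 rate] := last_guided_rate_le hH c11.
have [cs cs0 sinP] := sqint_sin_uniform oom om0.
have [c c0 massP] := strip_mass_ge ha ab bH.
pose L := H - h0; have L0 : 0 < L by rewrite subr_gt0.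
exists (cs * c), (2 * L * M); split; [exact: mulr_gt0|by rewrite !mulr_gt0|].
move=> k v [k1 _] [alpha [u [_ mode ->]]].
set lam := last_guided_eigenval H c1 k in mode *.
have mu := mode_measurable hH mode.
have [[_ lamP] _] := last_guided_eigenval_max hH c11 mode.
have [al [be [A [B [[al0 be0 al2 be2] ul ur [m1 m2] disp]]]]] :=
  guided_mode_form hH c11 mode lamP.
have al1 : 1 <= al.
  have := dispersion_root_gt_pi L0 al0 be0 disp; have := pi_ge2 R; lra.
have mab : measurable_fun `]a, b[ u.
  by apply: measurable_funS mu => // x /=; rewrite !in_itv/=; lra.
have mom := open_measurable oom.
rewrite /lower_estimate /Omega !sqnormL2_mode//.
have beM := rate _ _ _ _ mode al0 be0 al2 be2; rewrite -/lam in beM.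
have expo : expR (- (2 * L * M) * lam `^ 4^-1) <= expR (- (2 * L) * be).
  rewrite ler_expR !mulNr lerN2 -[leRHS]mulrA ler_wpM2l//.
  by rewrite mulr_ge0// ltW.
rewrite muleCA lee_wpmul2l ?lee_fin ?sqr_ge0//.
rewrite -mulrA EFinM muleACA; apply: lee_pmul.
- by rewrite mule_ge0 ?sqint_ge0// lee_fin ltW.
- by rewrite mule_ge0 ?sqint_ge0// lee_fin mulr_ge0 ?expR_ge0// ltW.
- apply: le_trans (sinP k k1).
  rewrite -[leRHS]mule1 lee_wpmul2l ?lee_fin ?(ltW cs0)//.
  exact: sqint_sin_le1.
- apply: le_trans (massP u al be A B mu al1 be0 ul ur m1 m2).
  by rewrite lee_wpmul2r ?sqint_ge0// lee_fin ler_wpM2l// ltW.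
Qed.

Lemma last_guided_upper_estimate H (c1 : R) a b (omega1 : set R) : h0 < H -> 1 < c1 ->
  open omega1 -> omega1 `<=` `]0, 1[ -> h0 < a -> a < b -> b < H ->
  exists C D : R, [/\ 0 < C, 0 < D & forall k v, lower_half_period c1 k ->
    last_guided_eigenfun H c1 k v ->
    upper_estimate H (omega1 `*` `]a, b[) C D (last_guided_eigenval H c1 k) v].
Proof.
move=> hH c11 oom omsub ha ab bH; have h00 := @h0_gt0 R.
have [m m0 rate] := guided_rate_ge hH c11.
have [C [D [C0 D0 massP]]] := strip_mass_le ha ab bH.
exists C, (D * m); split => //; first exact: mulr_gt0.
move=> k v lower [alpha [u [_ mode ->]]].
set lam := last_guided_eigenval H c1 k in mode *.
have mu := mode_measurable hH mode.
have [[_ lamP] _] := last_guided_eigenval_max hH c11 mode.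
have [al [be [A [B [[al0 be0 al2 be2] ul ur [m1 m2] disp]]]]] :=
  guided_mode_form hH c11 mode lamP.
have mab : measurable_fun `]a, b[ u.
  by apply: measurable_funS mu => // x /=; rewrite !in_itv/=; lra.
have mom := open_measurable oom.
rewrite /upper_estimate /Omega !sqnormL2_mode//.
have mbe := rate _ _ _ _ lower al0 be0 al2 be2 disp.
have expo : expR (- D * be) <= expR (- (D * m) * lam `^ 4^-1).
  by rewrite ler_expR !mulNr lerN2 -mulrA ler_wpM2l// ltW.
rewrite [leRHS]muleCA lee_wpmul2l ?lee_fin ?sqr_ge0//.
rewrite [leRHS]muleCA; apply: lee_pmul; rewrite ?sqint_ge0//.
  apply: sqint_subset => //.
  apply: measurable_funTS; apply: continuous_measurable_fun.
  apply: (@derivable_continuous _ _ (fun x => cos (k%:R * pi * x) * (k%:R * pi))) => x.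
  by der; ring.
apply: le_trans (massP u be B mu be0 ur) _.
by rewrite lee_wpmul2r ?sqint_ge0// lee_fin ler_wpM2l// ltW.
Qed.

Lemma nat_lower_half_period (c1 : R) k : Num.sqrt (c1 - 1) \is a Num.nat ->
  lower_half_period c1 k.
Proof.
move=> /natrP[j jE]; exists (j * k)./2, ((odd (j * k))%:R / 2); split.
  rewrite jE -natrM -[in LHS](odd_double_half (j * k)) natrD -mul2n natrM.
  by field.
by case: (odd _) => /=; lra.
Qed.

End Assembly.

Theorem proposition2p6 (R : realType) (H c1 a b : R) (omega1 : set R)
  (H_gt : h0 < H) (c1_gt1 : 1 < c1)
  (omega1_open : open omega1) (omega1_neq0 : omega1 !=set0)
  (omega1_sub : omega1 `<=` `]0, 1[) (a_lt_b : a < b)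
  (omega_sub : closure (omega1 `*` `]a, b[) `<=` Omega1 H) :
  let omega := (omega1 `*` `]a, b[) in
  let lamL := last_guided_eigenval H c1 in
  [/\ (exists C1' C2' : R,
        [/\ 0 < C1', 0 < C2' &
            forall k v, has_guided H c1 k -> last_guided_eigenfun H c1 k v ->
              lower_estimate H omega C1' C2' (lamL k) v]),
      (Num.sqrt (c1 - 1) \is a Num.nat ->
        exists C1 C1' C2 C2' : R,
        [/\ 0 < C1, 0 < C1', 0 < C2, 0 < C2' &
            forall k v, has_guided H c1 k -> last_guided_eigenfun H c1 k v ->
              lower_estimate H omega C1' C2' (lamL k) v /\
              upper_estimate H omega C1 C2 (lamL k) v]) &
      (Num.sqrt (c1 - 1) \isn't a Num.nat ->
        exists (C1 C1' C2 C2' : R) (K : set nat),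
        [/\ [/\ 0 < C1, 0 < C1', 0 < C2 & 0 < C2'],
            infinite_set K, K `<=` [set k | has_guided H c1 k] &
            forall k v, K k -> last_guided_eigenfun H c1 k v ->
              lower_estimate H omega C1' C2' (lamL k) v /\
              upper_estimate H omega C1 C2 (lamL k) v]) ].
Proof.
move=> omega lamL; have [x omx] := omega1_neq0.
have [ha bH] := closure_strip omx a_lt_b omega_sub.
have [C1' [C2' [C1'0 C2'0 lower]]] := last_guided_lower_estimate H_gt c1_gt1
  omega1_open omega1_neq0 omega1_sub ha a_lt_b bH.
have [C1 [C2 [C10 C20 upper]]] := last_guided_upper_estimate H_gt c1_gt1
  omega1_open omega1_sub ha a_lt_b bH.
split.
- by exists C1', C2'.
- move=> snat; exists C1, C1', C2, C2'; split => // k v kg kv.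
  by split; [exact: lower|apply: upper => //; exact: nat_lower_half_period].
- move=> _; exists C1, C1', C2, C2',
    [set k | has_guided H c1 k /\ lower_half_period c1 k].
  split; first by split.
  + exact: infinite_lower_half_period.
  + by move=> k [].
  + by move=> k v [kg klow] kv; split; [exact: lower|exact: upper].
Qed.
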